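(* Let $d \ge 2$ be an integer. There exists a constant $c_d>0$, depending only on $d$, such that for every convex body $K \subseteq \mathbb{R}^d$ and every $\varepsilon>0$ the following holds: if the width of $K$ in every direction is at least $\varepsilon$, then there exists a polytope $P$ with $K \subseteq P$ and Hausdorff distance between $K$ and $P$ at most $\varepsilon$, whose number of facets is at most \[ \left(\frac{c_d\,\Delta_{d-1}}{\varepsilon}\right)^{\frac{d-1}{2}}, \] where $\Delta_{d-1}$ is the surface diameter of $K$.
   Context: A convex body is a compact convex set with nonempty interior. The width of $K$ in direction $u$ (a unit vector) is the distance between the two supporting hyperplanes of $K$ orthogonal to $u$. The surface diameter $\Delta_{d-1}$ of $K$ is the diameter of a Euclidean ball in $\mathbb{R}^d$ whose surface area equals the surface area of $K$ (the $(d-1)$-dimensional Hausdorff measure of $\partial K$). *)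

(* Defs.v *)
From HB Require Import structures.
From mathcomp Require Import all_boot all_order all_algebra.
From mathcomp Require Import all_classical all_reals.
From mathcomp Require Import all_analysis.
Import numFieldNormedType.Exports.
Set Implicit Arguments. Unset Strict Implicit. Unset Printing Implicit Defensive.
Import Order.TTheory GRing.Theory Num.Theory.
Local Open Scope classical_set_scope.
Local Open Scope ring_scope.

Section Defs.
Variables (R : realType) (d : nat).
Local Notation V := 'rV[R]_d.

Definition dot (x y : V) : R := \sum_(i < d) x 0 i * y 0 i.
Definition enorm (x : V) : R := Num.sqrt (dot x x).

Definition cball (c : V) (r : R) : set V := [set x | enorm (x - c) <= r].

Definition boundary (A : set V) : set V :=
  [set x | forall e : R, 0 < e ->
     (exists2 y, A y & enorm (x - y) < e) /\
     (exists2 y, ~ A y & enorm (x - y) < e)].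

Definition convex_set (K : set V) : Prop :=
  forall x y t, K x -> K y -> 0 <= t -> t <= 1 -> K (t *: x + (1 - t) *: y).

Definition convex_body (K : set V) : Prop :=
  [/\ compact K, convex_set K &
      exists x r, 0 < r /\ [set y | enorm (y - x) < r] `<=` K].

Definition support_fun (K : set V) (u : V) : R := sup [set dot x u | x in K].
Definition width (K : set V) (u : V) : R := support_fun K u + support_fun K (- u).

Definition dist_to (x : V) (B : set V) : \bar R :=
  ereal_inf [set (enorm (x - b))%:E | b in B].
Definition hausdorff_dist (A B : set V) : \bar R :=
  maxe (ereal_sup [set dist_to a B | a in A]) (ereal_sup [set dist_to b A | b in B]).

(* diameter of a set (real sup; equals 0 for the empty set) *)
Definition diam (U : set V) : R := sup [set enorm (x - y) | x in U & y in U].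

(* s-dimensional Hausdorff measure, without the normalising constant
   (the constant is irrelevant for the surface diameter) *)
Definition hausdorff_delta (s : nat) (delta : R) (A : set V) : \bar R :=
  ereal_inf [set (\sum_(i <oo) ((diam (U i)) ^+ s)%:E)%E
            | U in [set U : nat -> set V |
                A `<=` \bigcup_i U i /\
                forall i x y, U i x -> U i y -> enorm (x - y) <= delta]].
Definition hausdorff_measure (s : nat) (A : set V) : \bar R :=
  ereal_sup [set hausdorff_delta s delta A | delta in [set delta : R | 0 < delta]].

Definition polytope (P : set V) : Prop :=
  exists n (a : 'I_n -> V) (b : 'I_n -> R),
    P = [set x | forall i, dot (a i) x <= b i] /\
    exists M : R, forall x, P x -> enorm x <= M.

Definition affinely_independent k (p : 'I_k -> V) : Prop :=
  forall lam : 'I_k -> R, \sum_(i < k) lam i = 0 ->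
    \sum_(i < k) lam i *: p i = 0 -> forall i, lam i = 0.

(* a facet of P: a face P ∩ H (H supporting hyperplane) of dimension d-1,
   i.e. containing d affinely independent points *)
Definition facet (P F : set V) : Prop :=
  exists (u : V) (c : R), [/\ u != 0, (forall x, P x -> dot u x <= c),
    F = [set x | P x /\ dot u x = c] &
    exists p : 'I_d -> V, (forall i, F (p i)) /\ affinely_independent p].

Definition num_facets_le (P : set V) (N : R) : Prop :=
  exists (n : nat) (f : 'I_n -> set V),
    n%:R <= N /\ forall F, facet P F -> exists i, F = f i.

End Defs.

(* Main.v *)
(* Fix a cap width delta proportional to eps, and let L = K + eps B.  A unit
   normal u of K at x gives a cap of L of width delta with apex x + eps u.  Up to
   constants the cap is a skew box (an affine image of a cube), and the polar
   skew box around u consists of directions almost supporting L at the apex; the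
   two volumes multiply to about eps^d.  If two such boxes meet, either in space
   or among the directions, then one of the two halfspaces already cuts off
   everything beyond distance eps along the normal of the other.  Caps of volume
   at least a threshold are covered by a maximal disjoint family of boxes in the
   shell between K and L, whose volume is at most a constant times eps * area;
   the others by a maximal disjoint family of polar boxes in a ball of
   directions.  The threshold balancing the two counts gives the square root of
   area / eps^(d-1).

   Volumes are compared by counting points of a fine grid.  The width condition
   gives an inscribed ball of radius comparable to eps, so L lies in a bounded
   dilate of K and the shell is a Lipschitz image of (boundary K) x [0, eps]. *)
Require Import Defs.
From HB Require Import structures.
From mathcomp Require Import all_boot all_order all_algebra.
From mathcomp Require Import all_classical all_reals.
From mathcomp Require Import all_analysis.
From mathcomp Require Import ring lra zify.
Set Implicit Arguments.
Unset Strict Implicit.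
Unset Printing Implicit Defensive.
Import numFieldNormedType.Exports.
Import Order.TTheory GRing.Theory Num.Theory.
Local Open Scope classical_set_scope.
Local Open Scope ring_scope.

(** * Inner product and Euclidean norm *)

Section Euclid.
Variables (R : realType) (d : nat).
Implicit Types (x y z u v : 'rV[R]_d) (a b : R).

Lemma dotC x y : dot x y = dot y x.
Proof. by apply: eq_bigr => i _; rewrite mulrC. Qed.

Lemma dotDl x y z : dot (x + y) z = dot x z + dot y z.
Proof. by rewrite /dot -big_split; apply: eq_bigr => i _; rewrite mxE mulrDl. Qed.

Lemma dotZl a x y : dot (a *: x) y = a * dot x y.
Proof. by rewrite /dot mulr_sumr; apply: eq_bigr => i _; rewrite mxE mulrA. Qed.

Lemma dotNl x y : dot (- x) y = - dot x y.
Proof. by rewrite -scaleN1r dotZl mulN1r. Qed.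

Lemma dotBl x y z : dot (x - y) z = dot x z - dot y z.
Proof. by rewrite dotDl dotNl. Qed.

Lemma dotDr x y z : dot z (x + y) = dot z x + dot z y.
Proof. by rewrite !(dotC z) dotDl. Qed.

Lemma dotZr a x y : dot y (a *: x) = a * dot y x.
Proof. by rewrite !(dotC y) dotZl. Qed.

Lemma dotNr x y : dot y (- x) = - dot y x.
Proof. by rewrite !(dotC y) dotNl. Qed.

Lemma dotBr x y z : dot z (x - y) = dot z x - dot z y.
Proof. by rewrite !(dotC z) dotBl. Qed.

Definition dot_lin := (dotDl, dotDr, dotNl, dotNr, dotZl, dotZr).

Lemma dot0l x : dot 0 x = 0.
Proof. by rewrite -(scale0r 0) dotZl mul0r. Qed.

Lemma dot_suml (I : finType) (F : I -> 'rV[R]_d) y :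
  dot (\sum_i F i) y = \sum_i dot (F i) y.
Proof.
apply: (big_morph (fun x => dot x y)); last exact: dot0l.
by move=> x z; rewrite dotDl.
Qed.

Lemma dot_ge0 x : 0 <= dot x x.
Proof. by apply: sumr_ge0 => i _; rewrite -expr2 sqr_ge0. Qed.

Lemma dot_eq0 x : dot x x = 0 -> x = 0.
Proof.
move=> /eqP; rewrite psumr_eq0; last by move=> i _; rewrite -expr2 sqr_ge0.
move=> /allP h; apply/rowP => i; rewrite mxE.
have := h i (mem_index_enum i); rewrite /= -expr2 sqrf_eq0.
by move/eqP.
Qed.

Lemma enorm_ge0 x : 0 <= enorm x.
Proof. exact: sqrtr_ge0. Qed.

Lemma sqr_enorm x : enorm x ^+ 2 = dot x x.
Proof. by rewrite sqr_sqrtr // dot_ge0. Qed.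

Lemma enorm0 : enorm (0 : 'rV[R]_d) = 0.
Proof. by rewrite /enorm dot0l sqrtr0. Qed.

Lemma enorm_eq0 x : enorm x = 0 -> x = 0.
Proof. by move=> h; apply: dot_eq0; rewrite -sqr_enorm h expr0n. Qed.

Lemma enorm_gt0 x : x != 0 -> 0 < enorm x.
Proof.
move=> x0; rewrite lt_def enorm_ge0 andbT; apply: contra x0.
by move=> /eqP/enorm_eq0 ->.
Qed.

Lemma enormZ a x : enorm (a *: x) = `|a| * enorm x.
Proof. by rewrite /enorm !dot_lin mulrA -expr2 sqrtrM ?sqr_ge0// sqrtr_sqr. Qed.

Lemma enormN x : enorm (- x) = enorm x.
Proof. by rewrite /enorm dotNl dotNr opprK. Qed.

Lemma enormC x y : enorm (x - y) = enorm (y - x).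
Proof. by rewrite -enormN opprB. Qed.

Lemma enorm_le x a : 0 <= a -> (enorm x <= a) = (dot x x <= a ^+ 2).
Proof. by move=> a0; rewrite -sqr_enorm ler_sqr// nnegrE enorm_ge0. Qed.

Lemma enorm1 u : (enorm u = 1) -> dot u u = 1.
Proof. by move=> h; rewrite -sqr_enorm h expr1n. Qed.

Lemma enorm_unit x : x != 0 -> enorm ((enorm x)^-1 *: x) = 1.
Proof.
move=> x0; rewrite enormZ ger0_norm ?invr_ge0 ?enorm_ge0//.
by rewrite mulVf// gt_eqF// enorm_gt0.
Qed.

Lemma dot_le_enorm x y : dot x y <= enorm x * enorm y.
Proof.
have [->|x0] := eqVneq x 0; first by rewrite dot0l enorm0 mul0r.
have [->|y0] := eqVneq y 0; first by rewrite dotC dot0l enorm0 mulr0.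
have := dot_ge0 (enorm y *: x - enorm x *: y).
rewrite !dot_lin -!sqr_enorm (dotC y x).
have := enorm_gt0 x0; have := enorm_gt0 y0.
set a := enorm x; set b := enorm y; set c := dot x y => b0 a0.
rewrite [leRHS](_ : _ = (a * b) * (2 * (a * b - c))); last by ring.
by rewrite pmulr_rge0 ?mulr_gt0// pmulr_rge0// subr_ge0.
Qed.

Lemma normr_dot_le x y : `|dot x y| <= enorm x * enorm y.
Proof.
by rewrite ler_norml dot_le_enorm andbT lerNl -dotNl -(enormN x) dot_le_enorm.
Qed.

Lemma enormD x y : enorm (x + y) <= enorm x + enorm y.
Proof.
rewrite enorm_le ?addr_ge0 ?enorm_ge0// !dot_lin (dotC y x) -!sqr_enorm.
have := dot_le_enorm x y; nra.
Qed.

Lemma enormB_trans x y z : enorm (x - z) <= enorm (x - y) + enorm (y - z).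
Proof. by apply: le_trans (enormD _ _); rewrite addrA subrK. Qed.

Lemma normr_coord_le x k : `|x 0 k| <= enorm x.
Proof.
rewrite -ler_sqr ?nnegrE ?enorm_ge0 ?normr_ge0// sqr_enorm real_normK ?num_real//.
rewrite /dot (bigD1 k)//= expr2 lerDl.
by apply: sumr_ge0 => i _; rewrite -expr2 sqr_ge0.
Qed.

Lemma enorm_le_sum x : enorm x <= \sum_k `|x 0 k|.
Proof.
rewrite enorm_le ?sumr_ge0//.
rewrite /dot expr2 mulr_suml; apply: ler_sum => k _.
rewrite (le_trans (ler_norm _))// normrM ler_wpM2l// (bigD1 k)//= lerDl.
by rewrite sumr_ge0.
Qed.

End Euclid.

(** * Volume comparison by counting grid points *)

Section Packing.
Variables (R : realType) (d : nat).
Local Notation V := 'rV[R]_d.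

(** A parallelepiped presented by its facet normals: its edges are parallel to the basis dual to
    [w]. In the triangular case with positive diagonal its volume is the product of the
    [2 * t / w k 0 k]. *)
Definition skew_box (c : V) (w : 'I_d -> V) (t : R) : set V :=
  [set x | forall k, `|dot (x - c) (w k)| <= t].

(** The rank [rho] covers both orders of the coordinates: a basis and its dual are triangular in
    opposite orders. *)
Definition triangular (rho : 'I_d -> nat) (w : 'I_d -> V) :=
  forall k j, w k 0 j != 0 -> j = k \/ (rho j < rho k)%N.

(** Round [i] of the iteration settles all coordinates of rank below [i], so [n] rounds reach a
    fixed point. *)
Lemma triangular_fixpoint (I T : Type) (rho : I -> nat) (n : nat)
    (Phi : (I -> T) -> I -> T) (x0 : I -> T) :
  (forall k, rho k < n)%N ->
  (forall x y k, (forall j, (rho j < rho k)%N -> x j = y j) -> Phi x k = Phi y k) ->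
  exists x, forall k, Phi x k = x k.
Proof.
move=> rhon Phidep; exists (iter n Phi x0) => k; rewrite -iterS.
move: k (rhon k); elim: n {rhon} => // n IH k kn.
by apply: Phidep => j jk; apply: IH; apply: leq_trans jk _.
Qed.

(** Once the coordinates of lower rank are fixed, constraint [k] confines [x 0 k] to an interval of
    length [2 * (t / w k 0 k)], and the point takes grid value number [a k] in it. Choosing all
    coordinates at once is a triangular fixed-point problem. *)
Lemma skew_box_grid_point rho c (w : 'I_d -> V) (t : R) (M : nat) (a : 'I_d -> nat) :
  triangular rho w -> (forall k, 0 < w k 0 k) -> (0 < M)%N ->
  (forall k, (a k).+1%:R <= M%:R * (2 * (t / w k 0 k)) :> R) ->
  exists x, skew_box c w t x /\
    forall k, M%:R * x 0 k =
      (Num.ceil (M%:R * (x 0 k - (dot (x - c) (w k) + t) / w k 0 k)))%:~R + (a k)%:R.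
Proof.
move=> tri w0 M0 ale.
have Mr : 0 < M%:R :> R by rewrite ltr0n.
pose f k (x : 'I_d -> R) : R :=
  let X := \row_j x j in X 0 k - (dot (X - c) (w k) + t) / w k 0 k.
pose Phi (x : 'I_d -> R) k := ((Num.ceil (M%:R * f k x))%:~R + (a k)%:R) / M%:R : R.
have fE k x : f k x =
    c 0 k - t / w k 0 k - (\sum_(j | j != k) (x j - c 0 j) * w k 0 j) / w k 0 k.
  rewrite /f /dot (bigD1 k)//= !mxE.
  under eq_bigr do rewrite !mxE.
  have := w0 k; move=> /lt0r_neq0 wn0; by field.
have [||y yE] := @triangular_fixpoint 'I_d R rho (\max_k rho k).+1 Phi (fun=> 0).
- by move=> k; rewrite ltnS leq_bigmax.
- move=> x y k xy; rewrite /Phi !fE; congr (((Num.ceil (_ * (_ - _ / _)))%:~R + _) / _).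
  apply: eq_bigr => j jk; have [->|wkj] := eqVneq (w k 0 j) 0; first by rewrite !mulr0.
  by case: (tri _ _ wkj) => [jk'|/xy -> //]; rewrite jk' eqxx in jk.
have E k : M%:R * (\row_j y j) 0 k =
      (Num.ceil (M%:R * f k y))%:~R + (a k)%:R.
  by rewrite mxE -[LHS]mulrC -[in LHS]yE /Phi divfK// gt_eqF.
exists (\row_j y j); split; last exact: E.
move=> k; have := E k; rewrite /f.
set X := \row_j y j; set s := dot _ _; have wk := w0 k.
have -> : s = s / w k 0 k * w k 0 k by rewrite divfK// gt_eqF.
have -> : t = t / w k 0 k * w k 0 k by rewrite divfK// gt_eqF.
rewrite -mulrDl mulfK ?gt_eqF// normrM (gtr0_norm wk) ler_pM2r//.
set S := s / _; have := ale k; set l := t / _ => {}ale Ek.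
have /andP[h1 h2] := real_ceil_itv (num_real (M%:R * (X 0 k - (S + l)))).
rewrite intrD /= in h1; rewrite -natr1 in ale.
have an : 0 <= (a k)%:R :> R by rewrite ler0n.
by rewrite ler_norml; apply/andP; split; rewrite -(ler_pM2l Mr); nra.
Qed.

Lemma card_family_prod (n : nat) (F : 'I_d -> pred 'I_n) :
  #|family F| = (\prod_k #|F k|)%N.
Proof. by rewrite card_family foldrE big_map big_enum. Qed.

Lemma card_ord_lt (n m : nat) : (m <= n)%N -> #|[pred i : 'I_n | (i < m)%N]| = m.
Proof.
by move=> mn; rewrite -sum1_card -(big_ord_widen n (fun=> 1%N) mn) sum1_card card_ord.
Qed.

Definition grid_point (M B n : nat) (z : {ffun 'I_d -> 'I_n}) : V :=
  \row_k ((z k)%:R / M%:R - B%:R).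

Lemma grid_pointP (M B : nat) (x : V) : (0 < M)%N ->
  (forall k, `|x 0 k| <= B%:R) -> (forall k, M%:R * x 0 k \is a Num.int) ->
  exists z : {ffun 'I_d -> 'I_(2 * B * M).+1}, grid_point M B z = x.
Proof.
move=> M0 xB xint; have Mr : 0 < M%:R :> R by rewrite ltr0n.
have zk k : exists z : 'I_(2 * B * M).+1, z%:R = M%:R * (x 0 k + B%:R) :> R.
  have /intrP[p pE] := xint k; have := xB k; rewrite ler_norml => /andP[x1 x2].
  have E : (p + (M * B)%:Z)%:~R = M%:R * (x 0 k + B%:R) :> R.
    by rewrite intrD -pE mulrDr -natrM.
  have q0 : 0 <= p + (M * B)%:Z by rewrite -(ler_int R) E; nra.
  have q1 : p + (M * B)%:Z <= (2 * B * M)%:Z.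
    by rewrite -(ler_int R) E -pmulrn !natrM; nra.
  have q2 : (`|(p + (M * B)%:Z)%R| < (2 * B * M).+1)%N by lia.
  by exists (Ordinal q2); rewrite /= -E pmulrn gez0_abs.
have [g gE] := choice zk; exists [ffun k => g k].
apply/rowP => k; rewrite mxE ffunE gE; field.
by rewrite gt_eqF.
Qed.

(** The offsets [a] of [skew_box_grid_point] can be read off from the point, so the box has at least
    as many grid points as there are offsets. Offset [k] takes [n k > 2 * M * l k - 1 >= M * l k]
    values. *)
Lemma card_skew_box_ge rho c (w : 'I_d -> V) (t : R) (M B : nat) :
  triangular rho w -> (forall k, 0 < w k 0 k) -> (0 < M)%N ->
  (forall x k, skew_box c w t x -> `|x 0 k| <= B%:R) ->
  (forall k, 1 <= M%:R * (t / w k 0 k)) ->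
  M%:R ^+ d * (\prod_k (t / w k 0 k)) <=
  #|[set z : {ffun 'I_d -> 'I_(2 * B * M).+1} |
       `[< skew_box c w t (grid_point M B z) >] ]%SET|%:R.
Proof.
move=> tri w0 M0 bB Mt; set A := [set z | _]%SET.
have Mr : 0 < M%:R :> R by rewrite ltr0n.
pose l k := t / w k 0 k.
pose n k := Num.truncn (M%:R * (2 * l k)).
have nle k : (n k)%:R <= M%:R * (2 * l k) < (n k).+1%:R.
  by apply: truncn_itv; have := Mt k; rewrite -/(l k); nra.
pose n' := (\max_k n k).+1.
pose F k : pred 'I_n' := [pred i : 'I_n' | (i < n k)%N].
pose g (z : {ffun 'I_d -> 'I_(2 * B * M).+1}) : {ffun 'I_d -> 'I_n'} := let x := grid_point M B z in
  [ffun k => inord (Num.truncn (M%:R * x 0 k -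
  (Num.ceil (M%:R * (x 0 k - (dot (x - c) (w k) + t) / w k 0 k)))%:~R))].
have sub : family F \subset [set g z | z in A]%SET.
  apply/fintype.subsetP => a /familyP aF.
  have [|x [xb xE]] := @skew_box_grid_point rho c w t M (fun k => a k) tri w0 M0.
    move=> k; have := aF k; rewrite inE => ak.
    by case/andP: (nle k) => h _; apply: le_trans h; rewrite ler_nat.
  have [||z zE] := @grid_pointP M B x M0.
  - by move=> k; apply: bB.
  - by move=> k; rewrite xE rpredD ?intr_int ?natr_int.
  apply/imsetP; exists z; first by rewrite inE zE; apply/asboolP.
  apply/ffunP => k; rewrite ffunE zE; apply/val_inj; rewrite /= xE.
  by rewrite addrAC subrr add0r natrK inord_val.
have := leq_trans (subset_leq_card sub) (leq_imset_card _ _).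
rewrite card_family_prod -(ler_nat R); apply: le_trans.
rewrite natr_prod -[X in _ ^+ X]card_ord -prodr_const -big_split /=.
apply: ler_prod => k _; have := Mt k; have := nle k.
rewrite -/(l k) -natr1 card_ord_lt ?leqW ?leq_bigmax// => /andP[h1 h2] h3.
by apply/andP; split; lra.
Qed.

(** Relative to one grid point of [W], all others have index offsets between [-m] and [m]; this
    leaves at most [(2 * m + 1) ^ d] points, and [1 <= M * D] absorbs the 1. *)
Lemma card_grid_le (M B n : nat) (W : set V) (D : R) : (0 < M)%N ->
  (forall x y k, W x -> W y -> `|x 0 k - y 0 k| <= D) -> 1 <= M%:R * D ->
  #|[set z : {ffun 'I_d -> 'I_n} | `[< W (grid_point M B z) >] ]%SET|%:R
    <= M%:R ^+ d * (4 * D) ^+ d.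
Proof.
move=> M0 WD MD; have Mr : 0 < M%:R :> R by rewrite ltr0n.
set A := [set z | _]%SET.
have [->|[z0 z0A]] := set_0Vmem A.
  by rewrite cards0 -exprMn exprn_ge0//; nra.
have D0 : 0 <= M%:R * D by lra.
pose m := Num.truncn (M%:R * D).
have /andP[m1 m2] : m%:R <= M%:R * D < m.+1%:R by exact: truncn_itv.
pose f (z : {ffun 'I_d -> 'I_n}) : {ffun 'I_d -> 'I_(2 * m).+1} :=
  [ffun k => inord (z k + m - z0 k)].
have close z k : z \in A -> (z k <= z0 k + m /\ z0 k <= z k + m)%N.
  move: z0A; rewrite !finset.in_set => /asboolP w0 /asboolP w1.
  have := WD _ _ k w1 w0; rewrite !mxE.
  rewrite (_ : _ - _ = ((z k)%:R - (z0 k)%:R) / M%:R); last by field; rewrite gt_eqF.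
  rewrite normrM [X in _ * X]ger0_norm ?invr_ge0 ?ler0n// ler_pdivrMr//.
  rewrite [D * _]mulrC => h; move: (le_lt_trans h m2); rewrite ltr_norml.
  move=> /andP[h1 h2].
  have : (z k < z0 k + m.+1)%N by rewrite -(ltr_nat R) natrD; lra.
  have : (z0 k < z k + m.+1)%N by rewrite -(ltr_nat R) natrD; lra.
  by rewrite !addnS !ltnS.
have finj : {in A &, injective f}.
  move=> z1 z2 z1A z2A /ffunP E; apply/ffunP => k; apply/val_inj => /=.
  have := congr1 val (E k); rewrite !ffunE /= !inordK.
  - case: (close z1 k z1A); case: (close z2 k z2A).
    by move: (z1 k : nat) (z2 k : nat) (z0 k : nat) => p1 p2 p0; lia.
  - by case: (close z2 k z2A); move: (z2 k : nat) (z0 k : nat) => p1 p0; lia.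
  - by case: (close z1 k z1A); move: (z1 k : nat) (z0 k : nat) => p1 p0; lia.
rewrite -(card_in_imset finj).
apply: le_trans (_ : ((2 * m).+1 ^ d)%:R <= _).
  rewrite ler_nat; apply: leq_trans (max_card _) _.
  by rewrite card_ffun !card_ord.
rewrite -exprMn natrX; apply: lerXn2r; rewrite ?nnegrE ?ler0n//; first by nra.
by rewrite -natr1 natrM; lra.
Qed.

(** On a grid of mesh [1 / M] each box holds at least [M ^ d * v] points and each [W j] at most
    [M ^ d * (4 * D j) ^ d]. A grid point lies in at most one box, and then also in some [W j];
    comparing counts cancels [M ^ d]. *)
Lemma skew_box_packing rho (N : nat) (J : finType) (c : 'I_N -> V)
    (w : 'I_N -> 'I_d -> V) (t : 'I_N -> R) (W : J -> set V) (D : J -> R) (v B : R) :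
  (forall q, triangular rho (w q)) -> (forall q k, 0 < w q k 0 k) ->
  (forall q, 0 < t q) -> (forall q, v <= \prod_k (t q / w q k 0 k)) ->
  (forall q q' x, skew_box (c q) (w q) (t q) x -> skew_box (c q') (w q') (t q') x ->
     q = q') ->
  (forall q x k, skew_box (c q) (w q) (t q) x -> `|x 0 k| <= B) ->
  (forall q x, skew_box (c q) (w q) (t q) x -> exists j, W j x) ->
  (forall j, 0 < D j) ->
  (forall j x y k, W j x -> W j y -> `|x 0 k - y 0 k| <= D j) ->
  N%:R * v <= \sum_j (4 * D j) ^+ d.
Proof.
move=> tri w0 t0 vle dis bB cov D0 WD.
(* Any [M] above [S] makes the mesh finer than every [t q / w q k 0 k] and every [D j], as the two
   counts demand. *)
pose S := (\sum_q \sum_k (w q k 0 k / t q)) + \sum_j (D j)^-1.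
have S1 : 0 <= \sum_q \sum_k (w q k 0 k / t q).
  by apply: sumr_ge0 => q _; apply: sumr_ge0 => k _; rewrite divr_ge0// ltW.
have S2 : 0 <= \sum_j (D j)^-1 by apply: sumr_ge0 => j _; rewrite invr_ge0 ltW.
pose M := (Num.truncn S).+1.
have SM : S <= M%:R.
  by have /andP[_ /ltW] := truncn_itv (addr_ge0 S1 S2).
have M0 : (0 < M)%N by [].
have Mr : 0 < M%:R :> R by rewrite ltr0n.
have Mt q k : 1 <= M%:R * (t q / w q k 0 k).
  have wt : 0 < t q / w q k 0 k by rewrite divr_gt0.
  rewrite -ler_pdivrMr// mul1r invf_div; apply: le_trans SM.
  rewrite /S (bigD1 q)//= (bigD1 k)//= -!addrA lerDl !addr_ge0//.
    by apply: sumr_ge0 => i _; rewrite divr_ge0// ltW.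
  by apply: sumr_ge0 => i _; apply: sumr_ge0 => j _; rewrite divr_ge0// ltW.
have MD j : 1 <= M%:R * D j.
  rewrite -ler_pdivrMr// mul1r; apply: le_trans SM.
  rewrite /S (bigD1 j)//= addrCA lerDl addr_ge0// sumr_ge0// => i _.
  by rewrite invr_ge0 ltW.
pose b := (Num.truncn `|B|).+1.
have Bb : B <= b%:R.
  apply: le_trans (ler_norm _) _.
  by have /andP[_ /ltW] := truncn_itv (normr_ge0 B).
have bb q x k : skew_box (c q) (w q) (t q) x -> `|x 0 k| <= b%:R.
  by move=> /bB h; apply: le_trans (h k) Bb.
pose Z := {ffun 'I_d -> 'I_(2 * b * M).+1}.
pose A q : {set Z} := [set z | `[< skew_box (c q) (w q) (t q) (grid_point M b z) >] ]%SET.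
pose C j : {set Z} := [set z | `[< W j (grid_point M b z) >] ]%SET.
have cA q : M%:R ^+ d * v <= #|A q|%:R.
  apply: le_trans (card_skew_box_ge (tri q) (w0 q) M0 (bb q) (Mt q)).
  by rewrite ler_pM2l ?exprn_gt0.
have cC j : #|C j|%:R <= M%:R ^+ d * (4 * D j) ^+ d.
  by apply: card_grid_le => // x y k; apply: WD.
have AC : (\sum_q #|A q| <= \sum_j #|C j|)%N.
  have cE (T : finType) (E : T -> {set Z}) :
      (\sum_q #|E q| = \sum_z \sum_q (z \in E q))%N.
    by rewrite exchange_big; apply: eq_bigr => q _; rewrite -sum1_card big_mkcond.
  rewrite !cE; apply: leq_sum => z _.
  have [q zq|no] := pickP (fun q => z \in A q); last by rewrite big1// => q _; rewrite no.
  rewrite (bigD1 q)//= zq big1 ?addn0; last first.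
    move=> q' q'q; apply/eqP; rewrite eqb0; apply: contra q'q.
    move: zq; rewrite !finset.in_set => /asboolP zq /asboolP zq'.
    by apply/eqP; apply: dis zq' zq.
  move: zq; rewrite finset.in_set => /asboolP /cov [j zj].
  by rewrite (bigD1 j)//= finset.in_set (asboolT zj).
move: AC; rewrite -(ler_nat R) !natr_sum => AC.
have := le_trans (ler_sum _ (fun q _ => cA q)) (le_trans AC (ler_sum _ (fun j _ => cC j))).
rewrite sumr_const card_ord -mulr_sumr -[_ *+ N]mulr_natl mulrCA.
by rewrite ler_pM2l ?exprn_gt0.
Qed.

End Packing.

(** * Skew boxes approximating a convex set *)

Section SkewBoxInConvex.
Variables (R : realType) (d : nat).
Local Notation V := 'rV[R]_d.

(** The separate weight [c] keeps the total positive when the sum is empty or all [a i] vanish. *)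
Lemma convex_set_sum (C : set V) (I : Type) (s : seq I) (P : pred I) (a : I -> R)
    (x : I -> V) (c : R) (x0 : V) :
  Defs.convex_set C -> 0 < c -> C x0 -> (forall i, P i -> 0 <= a i) ->
  (forall i, P i -> C (x i)) ->
  C ((c + \sum_(i <- s | P i) a i)^-1 *: (c *: x0 + \sum_(i <- s | P i) a i *: x i)).
Proof.
move=> Ccvx c0 Cx0 a0 Cx; elim: s => [|i s IH].
  by rewrite !big_nil !addr0 scalerA mulVf ?scale1r// gt_eqF.
rewrite !big_cons; case: ifP => // Pi.
set A := \sum_(i <- s | P i) a i; set X := \sum_(i <- s | P i) a i *: x i.
have A0 : 0 < c + A by rewrite ltr_pwDl// sumr_ge0.
have ai := a0 i Pi.
pose t := (c + A) / (c + (a i + A)).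
have -> : (c + (a i + A))^-1 *: (c *: x0 + (a i *: x i + X)) =
    t *: ((c + A)^-1 *: (c *: x0 + X)) + (1 - t) *: x i.
  by apply/rowP => j; rewrite !mxE /t; move: A0; set X' := X 0 j => A0; field; lra.
apply: Ccvx => //; first exact: Cx.
  by apply: divr_ge0; lra.
by rewrite ler_pdivrMr; lra.
Qed.

(** As [C] is not assumed closed, the supremum of the chords may not be attained; a chord longer
    than half of it suffices. *)
Lemma extremal_chord (C : set V) (B r : R) (c : V) (k : 'I_d) :
  (forall x, C x -> enorm x <= B) -> 0 < r -> (forall y, enorm (y - c) <= r -> C y) ->
  exists ab : V * V, [/\ C ab.1, C ab.2, forall j : 'I_d, (j < k)%N -> ab.1 0 j = ab.2 0 j,
    0 < ab.2 0 k - ab.1 0 k &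
    forall x y, C x -> C y -> (forall j : 'I_d, (j < k)%N -> x 0 j = y 0 j) ->
      x 0 k - y 0 k <= 2 * (ab.2 0 k - ab.1 0 k)].
Proof.
move=> CB r0 ball.
pose E := [set e : R | exists x y, [/\ C x, C y,
  (forall j : 'I_d, (j < k)%N -> x 0 j = y 0 j) & e = x 0 k - y 0 k]].
have Cr (e : R) : `|e| <= r -> C (c + e *: delta_mx 0 k).
  move=> er; apply: ball; rewrite addrAC subrr add0r enormZ.
  rewrite (_ : enorm _ = 1) ?mulr1//; rewrite /enorm /dot (bigD1 k)//= big1.
    by rewrite !mxE !eqxx mulr1 addr0 sqrtr1.
  by move=> i ik; rewrite !mxE (negbTE ik) andbF mulr0.
have Er : E (r + r).
  exists (c + r *: delta_mx 0 k), (c + (- r) *: delta_mx 0 k); split.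
  - by apply: Cr; rewrite gtr0_norm.
  - by apply: Cr; rewrite normrN gtr0_norm.
  - by move=> j jk; rewrite !mxE (_ : (j == k) = false) ?andbF ?mulr0// -val_eqE ltn_eqF.
  - by rewrite !mxE !eqxx /=; ring.
have sE : has_sup E.
  split; first by exists (r + r).
  exists (B + B) => _ [x [y [Cx Cy _ ->]]].
  have := normr_coord_le x k; have := normr_coord_le y k.
  have := CB _ Cx; have := CB _ Cy; rewrite !ler_norml => ? ? /andP[? ?] /andP[? ?]; lra.
have s0 : 0 < sup E by apply: lt_le_trans (ub_le_sup sE.2 Er); lra.
have [e [x [y [Cx Cy xy eE]]] es] := sup_adherent (divr_gt0 s0 (ltr0Sn R 1)) sE.
exists (y, x); split => //=.
- by move=> j jk; rewrite xy.
- by rewrite -eE; apply: lt_trans es; lra.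
move=> x' y' Cx' Cy' xy'; have : E (x' 0 k - y' 0 k) by exists x', y'.
by move=> /(ub_le_sup sE.2); rewrite -eE; lra.
Qed.

(** The [w k] are the columns of the inverse of the matrix with rows [v k]; inversion keeps a matrix
    upper triangular and inverts its diagonal. *)
Lemma upper_triangular_dual_basis (v : 'I_d -> V) :
  (forall k, 0 < v k 0 k) -> (forall k j : 'I_d, (j < k)%N -> v k 0 j = 0) ->
  exists w : 'I_d -> V, [/\ forall x, x = \sum_k dot x (w k) *: v k,
    triangular (fun j => j : nat) w & forall k, w k 0 k = (v k 0 k)^-1].
Proof.
move=> v0 vt; pose T := \matrix_(k, j) v k 0 j.
have Tu : T \in unitmx.
  rewrite unitmxE -det_tr det_trig; last first.
    by apply/is_trig_mxP => i j ij; rewrite !mxE vt.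
  rewrite unitfE; apply/prodf_neq0 => i _; by rewrite !mxE gt_eqF.
pose W := invmx T; have WT : W *m T = 1%:M by rewrite mulVmx.
have WTE i k : \sum_j W i j * v j 0 k = (i == k)%:R.
  have := congr1 (fun M : 'M[R]_d => M i k) WT; rewrite !mxE => <-.
  by apply: eq_bigr => j _; rewrite mxE.
have W0 n : forall k i : 'I_d, (k < n)%N -> (k < i)%N -> W i k = 0.
  elim: n => // n IH k i kn ki; have := WTE i k.
  rewrite (_ : (i == k) = false) -?val_eqE ?gtn_eqF// (bigD1 k)//= big1 ?addr0.
    by move/eqP; rewrite mulf_eq0 (gt_eqF (v0 k)) orbF => /eqP.
  move=> j; rewrite -val_eqE /= neq_ltn => /orP[jk|kj]; last by rewrite vt// mulr0.
  by rewrite (IH j i (leq_trans jk kn) (ltn_trans jk ki)) mul0r.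
exists (fun k => \row_i W i k); split.
- move=> x; apply/rowP => j; rewrite summxE.
  under eq_bigr do rewrite mxE /dot mulr_suml.
  rewrite exchange_big /=.
  under eq_bigr => i _ do under eq_bigr => k _ do rewrite mxE -mulrA.
  under eq_bigr => i _ do rewrite -mulr_sumr WTE.
  rewrite (bigD1 j)//= eqxx mulr1 big1 ?addr0// => i /negbTE ->; by rewrite mulr0.
- move=> k j; rewrite mxE => Wjk; case: (ltngtP k j) => [kj|jk|/val_inj ->].
  + by rewrite (W0 k.+1) ?eqxx in Wjk.
  + by right.
  + by left.
- move=> k; rewrite mxE; have := WTE k k; rewrite eqxx (bigD1 k)//= big1 ?addr0.
    by move=> h; apply: (mulIf (lt0r_neq0 (v0 k))); rewrite h mulVf// gt_eqF.
  move=> j; rewrite -val_eqE /= neq_ltn => /orP[jk|kj]; last by rewrite vt// mulr0.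
  by rewrite (W0 k j) ?mul0r.
Qed.

(** Closes the recursion in [convex_skew_box], where coefficient [k] is at most twice 1 plus the sum
    of the earlier ones. *)
Lemma sum_geom3 (k : nat) : 1 + \sum_(j < k) 2 * 3 ^+ j = 3 ^+ k :> R.
Proof.
elim: k => [|k IH]; first by rewrite big_ord0 addr0 expr0.
by rewrite big_ord_recr /= addrA IH exprS; ring.
Qed.

(* A triangular substitute for John's theorem: [v k] is a difference of two
   points of [C] that agree before coordinate [k] and whose [k]-th coordinates
   are, up to a factor 2, as far apart as possible. *)
Lemma convex_skew_box (C : set V) (B r : R) (p : V) : (0 < d)%N ->
  Defs.convex_set C -> (forall x, C x -> enorm x <= B) ->
  0 < r -> (forall y, enorm (y - p) <= r -> C y) ->
  exists (c : V) (v w : 'I_d -> V),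
    [/\ [/\ forall k, 0 < v k 0 k, triangular (fun j => d - j)%N v,
        triangular (fun j => j : nat) w, forall k, w k 0 k = (v k 0 k)^-1 &
        forall x, x = \sum_k dot x (w k) *: v k],
      skew_box c w (2 * d%:R)^-1 `<=` C &
      forall x y k, C x -> C y -> `|dot (x - y) (w k)| <= 2 * 3 ^+ d].
Proof.
move=> d0 Ccvx CB r0 ball.
have [ab abP] := choice (fun k => @extremal_chord C B r p k CB r0 ball).
pose a k := (ab k).1; pose b k := (ab k).2; pose v k := b k - a k.
have Ca k : C (a k) by case: (abP k).
have Cb k : C (b k) by case: (abP k).
have v0 k : 0 < v k 0 k by rewrite !mxE; case: (abP k).
have vt (k j : 'I_d) : (j < k)%N -> v k 0 j = 0.
  move=> jk; rewrite !mxE; case: (abP k) => _ _ /(_ _ jk) abE _ _.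
  by rewrite /a /b abE subrr.
have [w [vw wt wk]] := upper_triangular_dual_basis v0 vt.
have dr : 0 < d%:R :> R by rewrite ltr0n.
(* The centre is the average of the chord midpoints. *)
exists (\sum_k (2 * d%:R)^-1 *: (a k + b k)), v, w; split.
- split => // k j vkj.
  case: (ltngtP k j) => [kj|jk|/val_inj ->]; [|by rewrite vt ?eqxx in vkj|by left].
  by right; have := ltn_ord j; lia.
- set c := \sum_k _ => x xb; pose t k := dot (x - c) (w k).
  (* A point of the box is an average of points on the chords: [|t k| <= 1 / (2 * d)] keeps the
     parameter [1 / 2 + d * t k] between 0 and 1. *)
  have xE : x = \sum_k d%:R^-1 *: ((1 / 2 + d%:R * t k) *: b k + (1 - (1 / 2 + d%:R * t k)) *: a k).
    rewrite -[LHS](subrK c) {1}(vw (x - c)) -big_split /=; apply: eq_bigr => k _.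
    rewrite -/(t k) /v; apply/rowP => j; rewrite !mxE; field.
    by rewrite gt_eqF.
  pose m k := (1 / 2 + d%:R * t k) *: b k + (1 - (1 / 2 + d%:R * t k)) *: a k.
  have tk k : `|d%:R * t k| <= 1 / 2.
    rewrite normrM (gtr0_norm dr) -ler_pdivlMl//; apply: le_trans (xb k) _.
    by rewrite invfM mulrC mul1r.
  have Cm k : C (m k).
    by apply: Ccvx => //; have := tk k; rewrite ler_norml => /andP[? ?]; lra.
  have di : 0 < d%:R^-1 :> R by rewrite invr_gt0.
  pose k0 : 'I_d := Ordinal d0.
  have s1 : \sum_(k < d) d%:R^-1 = 1 :> R.
    by rewrite sumr_const card_ord -[_ *+ d]mulr_natr mulVf// gt_eqF.
  rewrite (bigD1 k0)//= in s1.
  have := @convex_set_sum C _ (index_enum 'I_d) (predC1 k0) (fun=> d%:R^-1) m _ _ Ccvx di (Cm k0).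
  rewrite s1 invr1 scale1r xE [\sum_k _ in X in _ -> X](bigD1 k0)//=.
  by apply => // i _; apply: ltW.
(* The bound is proved in the sharper form [2 * 3 ^ k], by strong induction on [k]. *)
- suff H n x y (k : 'I_d) : (k < n)%N -> C x -> C y -> `|dot (x - y) (w k)| <= 2 * 3 ^+ k.
    move=> x y k Cx Cy; apply: le_trans (H k.+1 x y k _ Cx Cy) _ => //.
    by rewrite ler_pM2l// ler_weXn2l ?ler1n// ltnW.
  elim: n x y k => // n IH x y k kn Cx Cy.
  pose s j := dot (x - y) (w j).
  pose mu := 1 + \sum_(j : 'I_d | (j < k)%N) `|s j|.
  have mu0 : 0 < mu by rewrite ltr_pwDl// sumr_ge0.
  have muk : mu <= 3 ^+ k.
    rewrite -sum_geom3 lerD2l (big_ord_widen d (fun j => 2 * 3 ^+ j)); last exact: ltnW.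
    by apply: ler_sum => j jk; apply: IH => //; apply: leq_trans jk _.
  (* Mixing [x] with the [e j] and [y] with the [f j], with weights [|s j|], cancels the components
     of [x - y] along [v j] for [j < k]. The two resulting points of [C] agree before coordinate
     [k], so [extremal_chord] gives [|s k| <= 2 * mu]. *)
  pose e j := if 0 <= s j then a j else b j.
  pose f j := if 0 <= s j then b j else a j.
  have Ce j : C (e j) by rewrite /e; case: ifP.
  have Cf j : C (f j) by rewrite /f; case: ifP.
  have efE j : `|s j| *: (f j - e j) = s j *: v j.
    rewrite /e /f /v; case: (lerP 0 (s j)) => sj; first by rewrite ger0_norm.
    by rewrite ltr0_norm// scaleNr -scalerN opprB.
  have Cq z g : C z -> (forall j, C (g j)) ->
      C (mu^-1 *: (1 *: z + \sum_(j : 'I_d | (j < k)%N) `|s j| *: g j)).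
    by move=> Cz Cg; apply: convex_set_sum.
  have Cp := Cq x e Cx Ce; have Cp' := Cq y f Cy Cf.
  set p1 := mu^-1 *: _ in Cp; set p2 := mu^-1 *: _ in Cp'.
  have pE : p1 - p2 = mu^-1 *: \sum_(j : 'I_d | (k <= j)%N) s j *: v j.
    rewrite -scalerBr; congr (_ *: _).
    rewrite !scale1r opprD addrACA -sumrB {1}(vw (x - y)) (bigID (fun j : 'I_d => (j < k)%N))/=.
    rewrite addrAC -big_split /= big1 ?add0r.
      by apply: eq_bigl => j; rewrite -leqNgt.
    move=> j jk; rewrite -/(s j) -efE -scalerBr -scalerDr.
    by rewrite addrC subrKA subrr scaler0.
  have pj (j : 'I_d) : (j < k)%N -> p1 0 j = p2 0 j.
    move=> jk; apply/eqP; rewrite -subr_eq0.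
    have -> : p1 0 j - p2 0 j = (p1 - p2) 0 j by rewrite !mxE.
    rewrite pE mxE summxE big1 ?mulr0// => i ki.
    by rewrite mxE vt ?mulr0//; apply: leq_trans ki.
  have pk : p1 0 k - p2 0 k = mu^-1 * (s k * v k 0 k).
    have -> : p1 0 k - p2 0 k = (p1 - p2) 0 k by rewrite !mxE.
    rewrite pE mxE summxE (bigD1 k)//= big1 ?addr0 ?mxE// => i /andP[ki ik].
    by rewrite mxE vt ?mulr0// ltn_neqAle eq_sym ki andbT.
  have [_ _ _ _ ext] := abP k.
  have h1 := ext _ _ Cp Cp' pj.
  have h2 := ext _ _ Cp' Cp (fun j jk => esym (pj j jk)).
  have vkE : (ab k).2 0 k - (ab k).1 0 k = v k 0 k by rewrite !mxE.
  rewrite vkE in h1 h2; rewrite pk in h1.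
  have {}h2 : - (mu^-1 * (s k * v k 0 k)) <= 2 * v k 0 k by rewrite -pk opprB.
  rewrite mulrA ler_pM2r// ler_pdivrMl// in h1.
  rewrite -mulrN -mulNr mulrA ler_pM2r// ler_pdivrMl// in h2.
  rewrite -/(s k) ler_norml; apply/andP; split; lra.
Qed.

End SkewBoxInConvex.

(** * Nearest points, boundaries and diameters *)

Section Topology.
Variables (R : realType) (d : nat).
Local Notation V := 'rV[R]_d.

Lemma continuous_coordB (a : V) k : continuous (fun x : V => x 0 k - a 0 k : R).
Proof.
by move=> x; apply: continuousB; [exact: coord_continuous|exact: cst_continuous].
Qed.

Lemma continuous_enormB (a : V) : continuous (fun x : V => enorm (x - a)).
Proof.
have cd : continuous (fun x : V => dot (x - a) (x - a) : R).
  apply: continuous_big => [|k _ x]; first exact: add_continuous.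
  have E : (fun y : V => (y - a) 0 k) = (fun y => y 0 k - a 0 k).
    by apply/funext => y; rewrite !mxE.
  by apply: (@continuousM R _ (fun y : V => (y - a) 0 k) (fun y : V => (y - a) 0 k));
    rewrite E; exact: continuous_coordB.
move=> x; apply: (@continuous_comp _ _ _ (fun x : V => dot (x - a) (x - a)) Num.sqrt).
  exact: cd.
exact: sqrt_continuous.
Qed.

Lemma open_enorm_ball (a : V) (e : R) : open [set x | enorm (x - a) < e].
Proof.
apply: (@open_comp _ _ (fun x : V => enorm (x - a)) [set y | y < e]).
  by move=> x _; apply: continuous_enormB.
exact: open_lt.
Qed.

Lemma compact_enorm_bounded (K : set V) : compact K ->
  exists B, forall x, K x -> enorm x <= B.
Proof.
move=> Kc; have [->|/set0P K0] := eqVneq K set0; first by exists 0.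
have [|c _ cmax] := @EVT_max_rV R d (fun x => enorm (x - 0)) K K0 Kc.
  by apply: continuous_subspaceT; exact: continuous_enormB.
by exists (enorm c) => x Kx; have := cmax x; rewrite !subr0; apply; rewrite inE.
Qed.

Lemma nearest_point (K : set V) (y : V) : compact K -> K !=set0 ->
  exists2 k, K k & forall x, K x -> enorm (y - k) <= enorm (y - x).
Proof.
move=> Kc K0.
have [|c cK cmin] := @EVT_min_rV R d (fun x => enorm (x - y)) K K0 Kc.
  by apply: continuous_subspaceT; exact: continuous_enormB.
exists c; first by rewrite inE in cK.
by move=> x Kx; rewrite !(enormC y); apply: cmin; rewrite inE.
Qed.

Lemma nearest_point_normal (K : set V) (y k : V) : Defs.convex_set K -> K k ->
  (forall x, K x -> enorm (y - k) <= enorm (y - x)) ->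
  forall x, K x -> dot (x - k) (y - k) <= 0.
Proof.
move=> Kcvx Kk kmin x Kx; rewrite leNgt; apply/negP => s0.
set s := dot _ _ in s0; set n := dot (x - k) (x - k).
have n0 : 0 <= n by exact: dot_ge0.
(* moving from k towards x by t decreases |y - .|^2 by 2 t s - t^2 n *)
pose t := s / (s + n); have sn : 0 < s + n by lra.
have t0 : 0 < t by rewrite divr_gt0.
have t1 : t <= 1 by rewrite ler_pdivrMr// mul1r; lra.
have := kmin _ (Kcvx x k t Kx Kk (ltW t0) t1).
rewrite enorm_le ?enorm_ge0// sqr_enorm.
have -> : y - (t *: x + (1 - t) *: k) = (y - k) - t *: (x - k).
  by apply/rowP => j; rewrite !mxE; ring.
have key (Y X : V) : dot (Y - t *: X) (Y - t *: X) = dot Y Y - 2 * t * dot X Y + t ^+ 2 * dot X X.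
  by rewrite !dot_lin (dotC Y X); ring.
rewrite key -/s -/n.
have tn : t * (s + n) = s by rewrite divfK// gt_eqF.
nra.
Qed.

Lemma boundary_sub_compact (K : set V) : compact K -> boundary K `<=` K.
Proof.
move=> Kc x bx; have [[y Ky _] _] := bx 1 ltr01.
have [|k Kk kmin] := @nearest_point K x Kc; first by exists y.
suff -> : x = k by [].
apply/eqP; rewrite -subr_eq0; apply: contraT => /enorm_gt0 e0.
have [[z Kz xz] _] := bx _ e0.
by have := kmin z Kz; rewrite leNgt xz.
Qed.

Lemma closed_boundary (K : set V) : closed (boundary K).
Proof.
move=> x clx e e0; have e2 : 0 < e / 2 by lra.
have [|z [bz xz]] := clx [set z | enorm (z - x) < e / 2].
  by apply: open_nbhs_nbhs; split; [exact: open_enorm_ball|rewrite /= subrr enorm0].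
rewrite /= enormC in xz.
have [[y Ky zy] [y' Ky' zy']] := bz _ e2.
by split; [exists y|exists y'] => //;
  apply: le_lt_trans (enormB_trans _ z _) _; lra.
Qed.

Lemma compact_boundary (K : set V) : compact K -> compact (boundary K).
Proof.
move=> Kc; exact: (subclosed_compact (@closed_boundary K) Kc (boundary_sub_compact Kc)).
Qed.

(** The bound [D] matters: [sup] of an unbounded set takes the default value 0. *)
Lemma enorm_le_diam (U : set V) (D : R) x y :
  (forall x y, U x -> U y -> enorm (x - y) <= D) ->
  U x -> U y -> enorm (x - y) <= diam U.
Proof.
move=> UD Ux Uy; apply: ub_le_sup.
  by exists D => _ [a Ua [b Ub <-]]; apply: UD.
by exists x => //; exists y.
Qed.

Lemma diam_ge0 (U : set V) : 0 <= diam U.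
Proof.
rewrite /diam; set E := [set _ | _ in _ & _ in _].
have [[[_ [x Ux [y Uy _]]] ub]|/sup_out -> //] := pselect (has_sup E).
apply: le_trans (enorm_ge0 (x - y)) _; apply: ub_le_sup => //.
by exists x => //; exists y.
Qed.

Lemma diam_le (U : set V) (D : R) : 0 <= D ->
  (forall x y, U x -> U y -> enorm (x - y) <= D) -> diam U <= D.
Proof.
move=> D0 UD; rewrite /diam; set E := [set _ | _ in _ & _ in _].
have [->|/set0P E0] := eqVneq E set0; first by rewrite sup0.
by apply: ge_sup => // _ [x Ux [y Uy <-]]; apply: UD.
Qed.

Lemma diam_set0 : diam (@set0 V) = 0.
Proof. by apply/eqP; rewrite eq_le diam_ge0 diam_le. Qed.

End Topology.

(** * Hausdorff measure and finite covers *)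

Section HausdorffCover.
Variables (R : realType) (d : nat).
Local Notation V := 'rV[R]_d.

Lemma exprD_le2 (a b : R) s : 0 <= a -> 0 <= b ->
  (a + b) ^+ s <= 2 ^+ s * (a ^+ s + b ^+ s).
Proof.
move=> a0 b0; case: (leP a b) => ab.
  apply: le_trans (_ : (2 * b) ^+ s <= _).
    by apply: lerXn2r; rewrite ?nnegrE; lra.
  by rewrite exprMn ler_pM2l ?exprn_gt0// lerDr exprn_ge0.
apply: le_trans (_ : (2 * a) ^+ s <= _).
  by apply: lerXn2r; rewrite ?nnegrE; lra.
by rewrite exprMn ler_pM2l ?exprn_gt0// lerDl exprn_ge0.
Qed.

Lemma sum_geom_half n : \sum_(i < n) (2 ^+ i.+1)^-1 = 1 - (2 ^+ n)^-1 :> R.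
Proof.
elim: n => [|n IH]; first by rewrite big_ord0 expr0 invr1 subrr.
rewrite big_ord_recr /= IH exprS invfM.
by set h := (2 ^+ n)^-1; field.
Qed.

(** A nearly optimal countable cover is fattened to open sets, and compactness leaves finitely many.
    The fattening [eta i] makes each [rho i] positive and decays geometrically, so that its powers
    sum to at most [c]. *)
Lemma hausdorff_finite_cover (s : nat) (A : set V) (c e : R) : (0 < s)%N ->
  compact A -> 0 < c -> 0 < e -> (hausdorff_measure s A <= c%:E)%E ->
  exists n (W : 'I_n -> set V) (rho : 'I_n -> R),
    [/\ forall x, A x -> exists i, W i x,
        forall i x y, W i x -> W i y -> enorm (x - y) <= rho i,
        forall i, 0 < rho i <= 2 * e &
        \sum_i rho i ^+ s <= 2 ^+ s * (3 * c)].
Proof.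
move=> s0 Ac c0 e0 HA.
have : (hausdorff_delta s e A < (2 * c)%:E)%E.
  apply: le_lt_trans (_ : c%:E < _)%E; last by rewrite lte_fin; lra.
  by apply: le_trans HA; apply: ereal_sup_ubound; exists e.
move=> /ereal_inf_lt[_ [U [AU Ue] <-] Usum].
(* [th <= e] gives [rho i <= 2 * e], [th <= 1] gives [eta i ^+ s <= eta i], and [th <= c] bounds the
   sum of the [eta i] by [c]. *)
pose th := Num.min e (Num.min 1 c).
have th0 : 0 < th by rewrite !lt_min e0 c0 ltr01.
have the : th <= e by rewrite ge_min lexx.
have th1 : th <= 1 by rewrite !ge_min lexx orbT.
have thc : th <= c by rewrite !ge_min lexx !orbT.
pose eta i := th / 2 ^+ i.+1.
have eta0 i : 0 < eta i by rewrite divr_gt0// exprn_gt0.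
have h2 i : 0 < ((2 : R) ^+ i.+1)^-1 <= 1.
  by rewrite invr_gt0 exprn_gt0//= invf_le1 ?exprn_gt0// exprn_ege1// ler1n.
have eta_th i : eta i <= th.
  by case/andP: (h2 i) => ? ?; rewrite /eta; nra.
pose W i := [set x | exists2 y, U i y & enorm (x - y) < eta i / 2].
have Wop i : open (W i).
  rewrite (_ : W i = \bigcup_(y in U i) [set x | enorm (x - y) < eta i / 2]).
    by apply: bigcup_open => y _; exact: open_enorm_ball.
  by rewrite predeqE => x; split => [[y Uy xy]|[y Uy xy]]; exists y.
have cA : cover_compact A by rewrite -compact_cover.
have [|D _ AD] := cA nat setT W (fun i _ => Wop i).
  move=> x /AU[i _ Ux]; exists i => //; exists x => //.
  by rewrite subrr enorm0 divr_gt0.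
(* One more than the largest index used, so the cover is an initial segment and its sum a partial
   sum of the series. *)
pose n := (\max_(i <- finmap.enum_fset D) i).+1.
exists n, (fun i => W i), (fun i => diam (U i) + eta i); split.
- move=> x /AD[i /= iD Wx].
  have ni : (i < n)%N by rewrite ltnS; apply: leq_bigmax_seq.
  by exists (Ordinal ni).
- move=> i x y [x' Ux xx] [y' Uy yy].
  have := enorm_le_diam (Ue i) Ux Uy; have := enormB_trans x x' y.
  have := enormB_trans x' y' y; rewrite (enormC y' y); lra.
- move=> i; have := diam_ge0 (U i); have := eta0 i; have := eta_th i.
  have := diam_le (ltW e0) (Ue i); move=> ? ? ? ?; apply/andP; split; lra.
apply: (@le_trans _ _ (\sum_(i < n) 2 ^+ s * (diam (U i) ^+ s + eta i ^+ s))).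
  by apply: ler_sum => i _; apply: exprD_le2; rewrite ?diam_ge0// ltW.
rewrite -mulr_sumr ler_pM2l ?exprn_gt0// big_split /=.
have S1 : \sum_(i < n) diam (U i) ^+ s <= 2 * c.
  rewrite -lee_fin; apply: le_trans (ltW Usum).
  rewrite -sumEFin -(big_mkord xpredT (fun i => (diam (U i) ^+ s)%:E)).
  by apply: nneseries_lim_ge => i _ _; rewrite lee_fin exprn_ge0// diam_ge0.
have S2 : \sum_(i < n) eta i ^+ s <= c.
  apply: le_trans (_ : \sum_(i < n) (c * (2 ^+ i.+1)^-1) <= _).
    apply: ler_sum => i _; have e1 : eta i <= 1 by apply: le_trans th1.
    apply: le_trans (_ : eta i <= _).
      by rewrite -(prednK s0) exprS ler_piMr// ?exprn_ile1// ltW.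
    by rewrite ler_pM2r//; case/andP: (h2 i).
  rewrite -mulr_sumr sum_geom_half.
  have : 0 < (2 ^+ n)^-1 :> R by rewrite invr_gt0 exprn_gt0.
  nra.
lra.
Qed.

(** The finite cover is continued by empty sets, which add nothing because their [diam] is 0 and [s]
    is positive. *)
Lemma hausdorff_delta_le_finite (I : finType) (s : nat) (A : set V) (e rho : R)
    (F : I -> set V) : (0 < s)%N -> 0 <= rho -> rho <= e ->
  (forall x, A x -> exists i, F i x) ->
  (forall i x y, F i x -> F i y -> enorm (x - y) <= rho) ->
  (hausdorff_delta s e A <= (#|I|%:R * rho ^+ s)%:E)%E.
Proof.
move=> s0 rho0 rhoe AF Frho.
pose U n : set V := if insub n is Some i then F (enum_val (i : 'I_#|I|)) else set0.
have Urho n x y : U n x -> U n y -> enorm (x - y) <= rho.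
  by rewrite /U; case: insubP => // i _ _; apply: Frho.
apply: le_trans (_ : (\sum_(n <oo) ((diam (U n)) ^+ s)%:E <= _)%E).
  apply: ereal_inf_lbound; exists U => //; split.
    move=> x /AF[i Fx]; exists (enum_rank i) => //; rewrite /U.
    by case: insubP => [j _ /val_inj ->|]; rewrite ?enum_rankK ?ltn_ord.
  by move=> n x y Ux Uy; apply: le_trans rhoe; apply: Urho Ux Uy.
apply: lime_le.
  by apply: is_cvg_nneseries => n _ _; rewrite lee_fin exprn_ge0// diam_ge0.
apply: nearW => N; rewrite sumEFin lee_fin.
apply: le_trans (_ : \sum_(0 <= n < (N + #|I|)%N) diam (U n) ^+ s <= _).
  rewrite (@big_cat_nat _ _ _ N 0 (N + #|I|)%N) ?leq_addr//= lerDl.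
  by apply: sumr_ge0 => i _; rewrite exprn_ge0// diam_ge0.
rewrite (@big_cat_nat _ _ _ #|I| 0 (N + #|I|)%N) ?leq_addl//=.
rewrite [X in _ + X]big_nat_cond [X in _ + X]big1 ?addr0; last first.
  move=> i /andP[/andP[Ii _] _]; rewrite /U; case: insubP => [j|_].
    by rewrite ltnNge Ii.
  by rewrite diam_set0 expr0n; case: s s0.
rewrite big_mkord mulr_natl -[X in _ *+ X]card_ord -sumr_const.
apply: ler_sum => i _; apply: lerXn2r; rewrite ?nnegrE ?diam_ge0//.
by apply: diam_le => //; apply: Urho.
Qed.

End HausdorffCover.

(** * Surface measure of a sphere *)

Section Sphere.
Variables (R : realType) (m : nat).
Local Notation d := m.+1.
Local Notation V := 'rV[R]_d.

Lemma unit_vector_large_coord (y : V) : dot y y = 1 ->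
  exists k, 1 <= d%:R * y 0 k ^+ 2.
Proof.
move=> y1; apply: contrapT => no.
have lt k : d%:R * y 0 k ^+ 2 < 1.
  by rewrite ltNge; apply/negP => h; apply: no; exists k.
have : \sum_(k < d) d%:R * y 0 k ^+ 2 < \sum_(k < d) (1 : R).
  by apply: ltr_sum => //; apply/hasP; exists 0; rewrite ?mem_index_enum.
rewrite sumr_const card_ord -mulr_sumr.
have -> : \sum_i y 0 i ^+ 2 = 1 by rewrite -y1; apply: eq_bigr => i _; rewrite expr2.
by rewrite mulr1 ltxx.
Qed.

(* On a patch of the unit sphere where one coordinate is bounded away from 0,
   that coordinate is a Lipschitz function of the others. *)
Lemma sphere_patch_diam (y y' : V) (k : 'I_d) (h : R) : 0 <= h ->
  dot y y = 1 -> dot y' y' = 1 ->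
  1 <= d%:R * y 0 k ^+ 2 -> 1 <= d%:R * y' 0 k ^+ 2 -> 0 <= y 0 k * y' 0 k ->
  (forall i, i != k -> `|y 0 i - y' 0 i| <= h) ->
  enorm (y - y') <= d%:R ^+ 2 * h.
Proof.
move=> h0 y1 y1' yk yk' same yh.
have le1 (z : V) i : dot z z = 1 -> `|z 0 i| <= 1.
  by move=> z1; apply: le_trans (normr_coord_le z i) _; rewrite /enorm z1 sqrtr1.
have sumh (F : 'I_d -> R) (c : R) : (forall i, i != k -> F i <= c) ->
    \sum_(i | i != k) F i <= m%:R * c.
  move=> Fc; apply: le_trans (ler_sum _ Fc) _.
  by rewrite sumr_const cardC1 card_ord mulr_natl.
(* The squares of the coordinates sum to 1, so the [k]-th square changes by minus the change of the
   others. *)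
have S2 : `|y 0 k ^+ 2 - y' 0 k ^+ 2| <= m%:R * (2 * h).
  have -> : y 0 k ^+ 2 - y' 0 k ^+ 2 = \sum_(i | i != k) (y' 0 i ^+ 2 - y 0 i ^+ 2).
    have E (z : V) : dot z z = 1 -> z 0 k ^+ 2 = 1 - \sum_(i | i != k) z 0 i ^+ 2.
      move=> <-; rewrite /dot (bigD1 k)//= -expr2.
      by under [X in _ + X - _]eq_bigr do rewrite -expr2; rewrite addrK.
    by rewrite (E y)// (E y')// sumrB; ring.
  apply: le_trans (ler_norm_sum _ _ _) _; apply: sumh => i ik.
  rewrite subr_sqr normrM distrC mulrC ler_pM ?normr_ge0 ?yh//.
  by apply: le_trans (ler_normD _ _) _; have := le1 y i y1; have := le1 y' i y1'; lra.
have dr : 1 <= d%:R :> R by rewrite ler1n.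
have big (t : R) : 1 <= d%:R * t ^+ 2 -> 1 <= d%:R * `|t|.
  rewrite -(real_normK (num_real t)); have := normr_ge0 t.
  move: (`|t|) => a a0 ha; nra.
(* As the signs agree, [|y 0 k + y' 0 k|] is at least [2 / d]; dividing the difference of squares by
   it bounds the difference. *)
have Sk : `|y 0 k - y' 0 k| <= m%:R * (d%:R * h).
  have : `|y 0 k + y' 0 k| = `|y 0 k| + `|y' 0 k|.
    case: (lerP 0 (y 0 k)) => s1; case: (lerP 0 (y' 0 k)) => s2.
    - by rewrite !ger0_norm ?addr_ge0.
    - have -> : y 0 k = 0 by nra.
      by rewrite normr0 !add0r ltr0_norm.
    - have -> : y' 0 k = 0 by nra.
      by rewrite normr0 !addr0 ltr0_norm.
    - by rewrite !ltr0_norm ?opprD//; lra.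
  move: S2; rewrite subr_sqr normrM => S2 sE; rewrite sE in S2.
  have := big _ yk; have := big _ yk'.
  move: S2; have := normr_ge0 (y 0 k - y' 0 k).
  move: (`|y 0 k - y' 0 k|) (`|y 0 k|) (`|y' 0 k|) => D a b D0 S2 b1 a1.
  have : D * 2 <= D * (d%:R * (a + b)) by apply: ler_wpM2l => //; lra.
  have -> : D * (d%:R * (a + b)) = d%:R * (D * (a + b)) by ring.
  have : d%:R * (D * (a + b)) <= d%:R * (m%:R * (2 * h)) by rewrite ler_wpM2l//; lra.
  lra.
apply: le_trans (enorm_le_sum _) _; rewrite (bigD1 k)//= !mxE.
have : \sum_(i < d | i != k) `|(y - y') 0 i| <= m%:R * h.
  by apply: sumh => i ik; rewrite !mxE yh.
move: Sk; rewrite -natr1; move: (m%:R : R) => M; nra.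
Qed.

Lemma boundary_cball_sub (x0 : V) (r : R) :
  boundary (cball x0 r) `<=` [set x | enorm (x - x0) = r].
Proof.
move=> x bx; apply/eqP; rewrite eq_le; apply/andP; split; apply/ler_addgt0Pr => e e0.
  have [[y yr xy] _] := bx e e0; rewrite /cball /= in yr.
  by have := enormB_trans x y x0; lra.
have [_ [y /negP yr xy]] := bx e e0; rewrite -ltNge in yr.
by have := enormB_trans y x x0; rewrite (enormC y x); lra.
Qed.

(** Patches are indexed by a large coordinate, its sign and the cell of mesh [1 / n] of the other
    coordinates. There are [2 * d * (2 * n + 1) ^ m] of them, of diameter at most [d ^ 2 * r / n],
    so the sum stays bounded as [n] grows. *)
Lemma hausdorff_sphere_le (x0 : V) (r : R) : (0 < m)%N -> 0 < r ->
  (hausdorff_measure m (boundary (cball x0 r)) <=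
     (2 * d%:R * (3 * d%:R ^+ 2 * r) ^+ m)%:E)%E.
Proof.
move=> m0 r0; apply: ge_ereal_sup => _ [e /= e0 <-].
have dr : 1 <= d%:R :> R by rewrite ler1n.
pose n := (Num.truncn (d%:R ^+ 2 * r / e)).+1.
have nr : 0 < n%:R :> R by rewrite ltr0n.
have ne : d%:R ^+ 2 * r / e <= n%:R.
  by apply: ltW; have /truncn_itv/andP[] : 0 <= d%:R ^+ 2 * r / e
    by rewrite divr_ge0 ?mulr_ge0 ?exprn_ge0 ?ltW.
pose y (x : V) := r^-1 *: (x - x0).
have xyE x x' : x - x' = r *: (y x - y x').
  by apply/rowP => j; rewrite !mxE; field; rewrite gt_eqF.
pose F (i : 'I_d * bool * {ffun 'I_m -> 'I_(2 * n).+1}) : set V := [set x |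
  [/\ dot (y x) (y x) = 1, 1 <= d%:R * y x 0 i.1.1 ^+ 2,
   (if i.1.2 then 0 <= y x 0 i.1.1 else y x 0 i.1.1 <= 0) &
   forall j, (i.2 j)%:R <= n%:R * (y x 0 (lift i.1.1 j) + 1) <= (i.2 j).+1%:R] ].
pose rho := d%:R ^+ 2 * n%:R^-1 * r.
have rho0 : 0 <= rho by rewrite !mulr_ge0 ?exprn_ge0 ?invr_ge0 ?ltW.
apply: (le_trans (@hausdorff_delta_le_finite R d _ m _ e rho F m0 rho0 _ _ _)).
- by rewrite /rho mulrAC ler_pdivrMr// -ler_pdivrMl// mulrC.
- move=> x /boundary_cball_sub /= xr.
  have y1 : dot (y x) (y x) = 1.
    by rewrite dotZl dotZr -sqr_enorm xr; field; rewrite gt_eqF.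
  have [k yk] := unit_vector_large_coord y1.
  have le1 i : `|y x 0 i| <= 1.
    by apply: le_trans (normr_coord_le _ i) _; rewrite /enorm y1 sqrtr1.
  pose b := 0 <= y x 0 k.
  have pos j : 0 <= n%:R * (y x 0 (lift k j) + 1).
    have := le1 (lift k j); rewrite ler_norml => /andP[? ?].
    by apply: mulr_ge0; [exact: ltW|lra].
  pose z := [ffun j : 'I_m => inord (Num.truncn (n%:R * (y x 0 (lift k j) + 1))) : 'I_(2 * n).+1].
  exists (k, b, z); split => //=.
    by rewrite /b; case: (leP 0 (y x 0 k)) => // /ltW.
  move=> j; have /andP[t1 t2] := truncn_itv (pos j).
  rewrite ffunE inordK ?t1 ?(ltW t2)// ltnS -(ler_nat R); apply: le_trans t1 _.
  have := le1 (lift k j); rewrite ler_norml natrM => /andP[? ?]; nra.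
- move=> [[k b] z] x x' [/= x1 xk xb xz] [/= x1' xk' xb' xz'].
  rewrite xyE enormZ gtr0_norm// mulrC /rho ler_pM2r//.
  apply: (@sphere_patch_diam _ _ k) => //.
    by case: b xb xb' => a1 a2; nra.
  move=> i; case: (unliftP k i) => [j ->|-> /eqP//] _.
  rewrite -[n%:R^-1]mul1r ler_pdivlMr//.
  have := xz j; have := xz' j; rewrite -natr1.
  set p := y x 0 _; set q := y x' 0 _ => /andP[h1 h2] /andP[h3 h4].
  by have [pq|pq] := lerP 0 (p - q); [rewrite ger0_norm|rewrite ltr0_norm]=> //; nra.
rewrite lee_fin !card_prod card_ffun card_bool !card_ord !natrM natrX.
rewrite [leLHS](_ : _ = 2 * d%:R * ((2 * n).+1%:R * rho) ^+ m); last first.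
  by rewrite [in RHS]exprMn [d%:R * 2]mulrC !mulrA.
rewrite ler_pM2l; last by lra.
apply: lerXn2r; rewrite ?nnegrE; first by rewrite mulr_ge0.
  by rewrite !mulr_ge0 ?exprn_ge0// ltW.
rewrite /rho -[(2 * n).+1%:R]natr1 natrM.
have n1 : 1 <= n%:R :> R by rewrite ler1n.
have -> : (2 * n%:R + 1) * (d%:R ^+ 2 * n%:R^-1 * r) =
   (2 + n%:R^-1) * (d%:R ^+ 2 * r) by field; rewrite gt_eqF.
rewrite -mulrA ler_wpM2r//; first by rewrite mulr_ge0 ?exprn_ge0// ltW.
have : n%:R^-1 <= 1 :> R by rewrite invf_le1.
lra.
Qed.
End Sphere.

(** * Facets of an intersection of halfspaces *)

Section Facets.
Variables (R : realType) (d : nat).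
Local Notation V := 'rV[R]_d.

(** Appending 1 to each of the [d] points gives a matrix of rank [d] with [d + 1] columns; [(u, -c)]
    and [(a, -b)] both lie in its one-dimensional kernel. *)
Lemma affine_hyperplane_unique (p : 'I_d -> V) (u a : V) (c b : R) :
  affinely_independent p -> u != 0 -> a != 0 ->
  (forall j, dot u (p j) = c) -> (forall j, dot a (p j) = b) ->
  exists mu, [/\ mu != 0, a = mu *: u & b = mu * c].
Proof.
move=> aff u0 a0 uc ab.
pose Q : 'M[R]_(d, d + 1) := row_mx (\matrix_j p j) (const_mx 1).
have Qfree : row_free Q.
  rewrite -kermx_eq0; apply/rowV0P => l /sub_kermxP lQ.
  move: lQ; rewrite mul_mx_row -(row_mx0 R 1 d 1) => /eq_row_mx[l1 l2].
  apply/rowP => j; rewrite mxE; apply: (aff (l 0)).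
    move/rowP/(_ 0): l2; rewrite !mxE => h; rewrite -[RHS]h.
    by apply: eq_bigr => i _; rewrite mxE mulr1.
  rewrite -[RHS]l1; apply/rowP => k; rewrite summxE mxE.
  by apply: eq_bigr => i _; rewrite !mxE.
pose ext (v : V) (e : R) : 'rV[R]_(d + 1) := row_mx v (const_mx (- e)).
have ext_ker v e : (forall j, dot v (p j) = e) -> (ext v e <= kermx Q^T)%MS.
  move=> ve; apply/sub_kermxP; rewrite tr_row_mx mul_row_col.
  apply/rowP => j; rewrite !mxE big_ord1 !mxE mulr1 -(ve j) /dot.
  by apply/eqP; rewrite subr_eq0; apply/eqP; apply: eq_bigr => i _; rewrite !mxE.
have ext_neq0 v e : v != 0 -> ext v e != 0.
  apply: contra => /eqP; rewrite -(row_mx0 R 1 d 1) => /eq_row_mx[-> _]; exact: eqxx.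
have kerE : (ext u c :=: kermx Q^T)%MS.
  apply/eqmxP; rewrite -(geq_leqif (mxrank_leqif_eq (ext_ker u c uc))).
  rewrite mxrank_ker mxrank_tr (eqP Qfree) addKn rank_rV.
  by rewrite ext_neq0.
have := ext_ker a b ab; rewrite -kerE => /sub_rVP[mu].
rewrite scale_row_mx => /eq_row_mx[aE bE]; exists mu; split => //.
  by apply: contra a0 => /eqP mu0; rewrite aE mu0 scale0r.
by move/rowP/(_ 0): bE; rewrite !mxE mulrN => /oppr_inj.
Qed.

(** At the barycentre [q] of [d] affinely independent points of the facet some constraint is tight,
    else [q] could be pushed outwards along [u] within the set. Tight at an average means tight at
    every point, so the two hyperplanes coincide. *)
Lemma facet_tight_halfspace n (a : 'I_n -> V) (b : 'I_n -> R) (F : set V) : (0 < d)%N ->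
  (forall i, a i != 0) -> facet [set x | forall i, dot (a i) x <= b i] F ->
  exists i, F = [set x | (forall i, dot (a i) x <= b i) /\ dot (a i) x = b i].
Proof.
move=> d0 a0 [u [c [u0 uc FE [p [Fp aff]]]]].
have Pp j : forall i, dot (a i) (p j) <= b i by have := Fp j; rewrite FE => -[].
have up j : dot u (p j) = c by have := Fp j; rewrite FE => -[].
have dr : 0 < d%:R :> R by rewrite ltr0n.
pose q := d%:R^-1 *: \sum_j p j.
have dotq v : dot v q = d%:R^-1 * \sum_j dot v (p j).
  by rewrite dotC dotZl dot_suml; congr (_ * _); apply: eq_bigr => j _; rewrite dotC.
have avg (e : R) : d%:R^-1 * \sum_(j < d) e = e.
  by rewrite sumr_const card_ord -[e *+ d]mulr_natl mulKf// gt_eqF.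
have uq : dot u q = c by rewrite dotq; under eq_bigr do rewrite up; rewrite avg.
have aq i : dot (a i) q <= b i.
  rewrite dotq -[leRHS]avg ler_pM2l ?invr_gt0//.
  by apply: ler_sum => j _; apply: Pp.
have [i iq] : exists i, dot (a i) q = b i.
  apply: contrapT => no.
  have slack i : 0 < b i - dot (a i) q.
    rewrite subr_gt0 lt_neqAle aq andbT; apply/eqP => h; apply: no; by exists i.
  (* [T] dominates every [|dot (a i) u|] divided by its slack, so a step of [T^-1] along [u]
     violates no constraint. *)
  pose T := 1 + \sum_i `|dot (a i) u| / (b i - dot (a i) q).
  have T0 : 0 < T by rewrite ltr_pwDl// sumr_ge0// => i _; rewrite divr_ge0// ltW.
  have : dot u (q + T^-1 *: u) <= c.
    apply: uc => i; rewrite dotDr (dotZr T^-1) -lerBrDl ler_pdivrMl//.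
    rewrite -ler_pdivrMr//; apply: le_trans (_ : `|dot (a i) u| / (b i - dot (a i) q) <= _).
      by rewrite ler_pM2r ?invr_gt0// ler_norm.
    rewrite /T (bigD1 i)//= addrCA lerDl addr_ge0// sumr_ge0// => j _.
    by rewrite divr_ge0// ltW.
  rewrite dotDr uq (dotZr T^-1) gerDl leNgt mulr_gt0 ?invr_gt0//.
  by rewrite -sqr_enorm exprn_gt0// enorm_gt0.
have ap j : dot (a i) (p j) = b i.
  have : \sum_j (b i - dot (a i) (p j)) == 0.
    rewrite sumrB subr_eq0 -(inj_eq (mulfI (invr_neq0 (lt0r_neq0 dr)))) avg -dotq.
    by rewrite iq.
  rewrite psumr_eq0; last by move=> k _; rewrite subr_ge0 Pp.
  move=> /allP /(_ j (mem_index_enum j)) /=.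
  by rewrite subr_eq0 => /eqP.
have [mu [mu0 aE bE]] := affine_hyperplane_unique aff u0 (a0 i) up ap.
exists i; rewrite FE predeqE => x /=; split=> -[Px xc]; split => //.
  by rewrite aE bE dotZl xc.
by apply: (mulfI mu0); rewrite -bE -dotZl -aE.
Qed.

End Facets.

(** * Parallel bodies, caps and normal rays *)

Section ConvexBodies.
Variables (R : realType) (d : nat).
Local Notation V := 'rV[R]_d.
Local Notation kappa := (2 * 3 ^+ d : R).

Definition normal_pair (K : set V) (x u : V) :=
  [/\ K x, enorm u = 1 & forall y, K y -> dot (y - x) u <= 0].

Definition parallel_body (K : set V) (e : R) : set V :=
  [set y | exists2 k, K k & enorm (y - k) <= e].

(** For a [normal_pair], the part of the parallel body within [delta] of its supporting hyperplane
    at the apex [x + e *: u]. *)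
Definition cap (K : set V) (e delta : R) (x u : V) : set V :=
  [set y | parallel_body K e y /\ dot (x + e *: u - y) u <= delta].

Lemma convex_parallel_body (K : set V) e : Defs.convex_set K ->
  Defs.convex_set (parallel_body K e).
Proof.
move=> Kc x y t [k Kk xk] [k' Kk' yk'] t0 t1.
exists (t *: k + (1 - t) *: k'); first exact: Kc.
have -> : t *: x + (1 - t) *: y - (t *: k + (1 - t) *: k') =
    t *: (x - k) + (1 - t) *: (y - k') by apply/rowP => j; rewrite !mxE; ring.
apply: le_trans (enormD _ _) _; rewrite !enormZ !ger0_norm ?subr_ge0//.
nra.
Qed.

Lemma convex_cap (K : set V) e delta x u : Defs.convex_set K ->
  Defs.convex_set (cap K e delta x u).
Proof.
move=> Kc y y' t [Ly yd] [Ly' yd'] t0 t1; split; first exact: convex_parallel_body.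
set z := x + _ in yd yd' *.
have -> : z - (t *: y + (1 - t) *: y') = t *: (z - y) + (1 - t) *: (z - y').
  by apply/rowP => j; rewrite !mxE; ring.
rewrite dotDl !dotZl; nra.
Qed.

Lemma parallel_body_bounded (K : set V) e B : (forall x, K x -> enorm x <= B) ->
  forall x, parallel_body K e x -> enorm x <= B + e.
Proof.
move=> KB x [k Kk xk]; have := enormD (x - k) k; rewrite subrK.
by have := KB k Kk; lra.
Qed.

Lemma apex_parallel_body (K : set V) e x u : 0 <= e -> normal_pair K x u ->
  parallel_body K e (x + e *: u).
Proof.
move=> e0 [Kx u1 _]; exists x => //.
by rewrite addrAC subrr add0r enormZ u1 mulr1 ger0_norm.
Qed.

Lemma parallel_body_support (K : set V) e x u y : 0 <= e -> normal_pair K x u ->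
  parallel_body K e y -> dot (y - (x + e *: u)) u <= 0.
Proof.
move=> e0 [Kx u1 un] [k Kk yk].
have -> : y - (x + e *: u) = (y - k) + (k - x) - e *: u.
  by apply/rowP => j; rewrite !mxE; ring.
rewrite dotBl dotDl dotZl (enorm1 u1) mulr1.
have := un k Kk; have := dot_le_enorm (y - k) u; rewrite u1 mulr1; lra.
Qed.

Lemma apex_cap (K : set V) e delta x u : 0 <= e -> 0 <= delta ->
  normal_pair K x u -> cap K e delta x u (x + e *: u).
Proof.
move=> e0 d0 n; split; first exact: apex_parallel_body.
by rewrite subrr dot0l.
Qed.

(** This ball of diameter [delta] touches the parallel body from inside at the apex; as
    [delta <= e], it lies in the ball of radius [e] around [x]. *)
Lemma ball_sub_cap (K : set V) e delta x u y : 0 <= delta -> delta <= e ->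
  normal_pair K x u ->
  enorm (y - (x + (e - delta / 2) *: u)) <= delta / 2 -> cap K e delta x u y.
Proof.
move=> d0 de [Kx u1 un] yc; split.
  exists x => //.
  have -> : y - x = (y - (x + (e - delta / 2) *: u)) + (e - delta / 2) *: u.
    by apply/rowP => j; rewrite !mxE; ring.
  apply: le_trans (enormD _ _) _; rewrite enormZ u1 mulr1 ger0_norm; lra.
have -> : x + e *: u - y = (delta / 2) *: u - (y - (x + (e - delta / 2) *: u)).
  by apply/rowP => j; rewrite !mxE; ring.
rewrite dotBl dotZl (enorm1 u1).
have := normr_dot_le (y - (x + (e - delta / 2) *: u)) u; rewrite u1 mulr1.
by rewrite ler_norml => /andP[? ?]; lra.
Qed.

Lemma width_le (K : set V) u B : K !=set0 ->
  (forall x y, K x -> K y -> dot (x - y) u <= B) -> width K u <= B.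
Proof.
move=> [z Kz] KB; rewrite /width /support_fun.
rewrite addrC -lerBrDr; apply: ge_sup; first by exists (dot z (- u)); exists z.
move=> _ [y Ky <-]; rewrite lerBrDr -lerBrDl.
apply: ge_sup; first by exists (dot z u); exists z.
move=> _ [x Kx <-]; have := KB x y Kx Ky; rewrite dotBl dotNr; lra.
Qed.

(** Differences of points of [K] pair with [w k] to at most [kappa], so width at least [e] forces
    [enorm (w k) <= kappa / e]. A ball of radius proportional to [e] then fits in the inscribed skew
    box. *)
Lemma inball_of_width (K : set V) (e : R) : (0 < d)%N -> convex_body K -> 0 < e ->
  (forall u, enorm u = 1 -> e <= width K u) ->
  exists p, forall y, enorm (y - p) <= e / (2 * d%:R * kappa) -> K y.
Proof.
move=> d0 [Kc Kcvx [x [r [r0 xr]]]] e0 wK.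
have [B KB] := compact_enorm_bounded Kc.
have r2 : 0 < r / 2 by lra.
have [|p [v [w [[v0 vt wt wk vw] box wid]]]] := @convex_skew_box R d K B (r / 2) x d0 Kcvx KB r2.
  by move=> y yx; apply: xr => /=; lra.
exists p => y yp; apply: box => k.
have k0 : 0 < kappa by rewrite mulr_gt0 ?exprn_gt0.
have dr : 0 < d%:R :> R by rewrite ltr0n.
have wn0 : w k != 0.
  apply/eqP => wk0; have := wk k; rewrite wk0 mxE => /esym/eqP.
  by rewrite invr_eq0 gt_eqF.
have wn := enorm_gt0 wn0.
have we : enorm (w k) <= kappa / e.
  rewrite ler_pdivlMr// mulrC -ler_pdivlMr//.
  apply: le_trans (wK _ (enorm_unit wn0)) _; apply: width_le.
    by exists x; apply: xr; rewrite /= subrr enorm0.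
  move=> a b Ka Kb; rewrite dotZr [leRHS]mulrC ler_pM2l ?invr_gt0//.
  exact: le_trans (ler_norm _) (wid a b k Ka Kb).
apply: le_trans (normr_dot_le _ _) _.
apply: le_trans (ler_pM (enorm_ge0 _) (enorm_ge0 _) yp we) _.
rewrite le_eqVlt; apply/orP; left; apply/eqP; field.
by rewrite !gt_eqF// exprn_gt0.
Qed.

(** If [y = k + z] with [enorm z <= e], then [p + (b / e) *: z] is in [K], and the shrunken point is
    a convex combination of it and [k]. *)
Lemma parallel_body_sub_dilate (K : set V) (p y : V) (e b : R) : 0 < b -> 0 <= e ->
  Defs.convex_set K -> (forall y, enorm (y - p) <= b -> K y) ->
  parallel_body K e y -> K (p + (1 + e / b)^-1 *: (y - p)).
Proof.
move=> b0 e0 Kcvx ball [k Kk yk].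
pose l := 1 + e / b.
have l0 : 0 < l by rewrite ltr_pwDl// divr_ge0// ltW.
have [e00|en0] := eqVneq e 0.
  rewrite e00 in yk *; suff -> : y = k by rewrite mul0r addr0 invr1 scale1r addrC subrK.
  apply/eqP; rewrite -subr_eq0; apply/eqP/enorm_eq0/eqP.
  by rewrite eq_le enorm_ge0 yk.
have ep : 0 < e by rewrite lt_neqAle eq_sym en0.
have Kz : K (p + (b / e) *: (y - k)).
  apply: ball; rewrite addrAC subrr add0r enormZ ger0_norm; last by rewrite divr_ge0// ltW.
  by rewrite mulrAC ler_pdivrMr// ler_pM2l.
have -> : p + l^-1 *: (y - p) = l^-1 *: k + (1 - l^-1) *: (p + (b / e) *: (y - k)).
  apply/rowP => j; rewrite !mxE /l; field.
  by rewrite !gt_eqF//; lra.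
apply: Kcvx => //; first by rewrite invr_ge0 ltW.
by rewrite invf_le1// lerDl divr_ge0// ltW.
Qed.

(** The ray from [k] along [u] is followed until it leaves the dilate of [K] by [l] about [p]; the
    supremum of the parameters inside gives a boundary point after rescaling. *)
Lemma boundary_ray (K : set V) (p k u : V) (l B t0 : R) : 0 < l ->
  (forall x, K x -> enorm x <= B) -> enorm u = 1 ->
  K (p + l^-1 *: (k + t0 *: u - p)) ->
  exists2 t, t0 <= t & boundary K (p + l^-1 *: (k + t *: u - p)).
Proof.
move=> l0 KB u1 K0.
pose g t := p + l^-1 *: (k + t *: u - p).
pose E := [set t | K (g t)].
have gE t t' : g t - g t' = (l^-1 * (t - t')) *: u.
  by apply/rowP => j; rewrite !mxE; ring.
have gn t t' : enorm (g t - g t') = l^-1 * `|t - t'|.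
  by rewrite gE enormZ u1 mulr1 normrM ger0_norm// invr_ge0 ltW.
have sE : has_sup E.
  split; first by exists t0.
  exists (l * (B + B) + t0) => t Et.
  have := gn t t0; have : enorm (g t - g t0) <= B + B.
    by apply: le_trans (enormD _ _) _; rewrite enormN lerD// KB.
  move=> h1 h2; rewrite h2 mulrC ler_pdivrMr// in h1.
  by have := ler_norm (t - t0); rewrite [l * _]mulrC; lra.
exists (sup E); first exact: ub_le_sup sE.2 _ K0.
move=> e e0; have le0 : 0 < l * e / 2 by rewrite divr_gt0 ?mulr_gt0.
split.
  have [t Et tE] := sup_adherent le0 sE; exists (g t) => //.
  rewrite -/(g (sup E)) gn ger0_norm ?subr_ge0; last exact: ub_le_sup sE.2 _ Et.
  by rewrite ltr_pdivrMl//; lra.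
exists (g (sup E + l * e / 2)).
  by move=> /(ub_le_sup sE.2); lra.
rewrite -/(g (sup E)) gn (_ : _ - _ = - (l * e / 2)); last by ring.
by rewrite normrN gtr0_norm// ltr_pdivrMl//; lra.
Qed.

(* Nearest-point projection onto a parallel body does not increase distances. *)
Lemma normal_ray_contraction (K : set V) (k u k' u' : V) (s t t' : R) :
  normal_pair K k u -> normal_pair K k' u' -> 0 <= s -> s <= t -> s <= t' ->
  enorm ((k + s *: u) - (k' + s *: u')) <= enorm ((k + t *: u) - (k' + t' *: u')).
Proof.
move=> [Kk u1 un] [Kk' u1' un'] s0 st st'.
set Y := _ - (k' + s *: _); set X := _ - (k' + t' *: _).
have uu : dot u u' <= 1 by have := dot_le_enorm u u'; rewrite u1 u1' mulr1.
(* The normal conditions give [dot Y u >= 0 >= dot Y u'], hence [dot Y X >= dot Y Y], and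
   Cauchy-Schwarz finishes. *)
have Yu : 0 <= dot Y u.
  have := un k' Kk'; rewrite /Y !dot_lin (enorm1 u1) (dotC u' u); nra.
have Yu' : dot Y u' <= 0.
  have := un' k Kk; rewrite /Y !dot_lin (enorm1 u1'); nra.
have XE : X = Y + (t - s) *: u - (t' - s) *: u'.
  by apply/rowP => j; rewrite /X /Y !mxE; ring.
have : dot Y Y <= dot Y X.
  have -> : dot Y X = dot Y Y + (t - s) * dot Y u - (t' - s) * dot Y u'.
    by rewrite XE; move: Y {Yu Yu' XE} => Y; rewrite !dot_lin.
  nra.
move=> YX; have := le_trans YX (dot_le_enorm Y X).
have [->|Y0] := eqVneq Y 0; first by rewrite enorm0 enorm_ge0.
by rewrite -sqr_enorm expr2 ler_pM2l// enorm_gt0.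
Qed.

(** With [dot (x - x') u' <= 0] the apex condition forces [dot u u' >= 1 / 2], so the ray from [x]
    along [u] rises in direction [u']; at height [e] it is already [e / 2] beyond the second
    hyperplane. *)
Lemma halfspace_cut (K : set V) (e t : R) (x u x' u' : V) : 0 < e ->
  normal_pair K x u -> normal_pair K x' u' ->
  dot ((x' + e *: u') - (x + e *: u)) u' <= e / 2 -> e < t ->
  dot x' u' < dot (x + t *: u) u'.
Proof.
move=> e1 [Kx u1 un] [Kx' u1' un'] h et.
have := un' x Kx.
move: h; rewrite !dot_lin (enorm1 u1'); move: (dot x' u') (dot x u') (dot u u') => a b c.
move=> h ab; have : 1 / 2 <= c by rewrite -(ler_pM2l e1); lra.
nra.
Qed.

End ConvexBodies.

(** * Cap boxes and their polar boxes *)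

Section CapBoxes.
Variables (R : realType) (d : nat).
Local Notation V := 'rV[R]_d.
Local Notation kappa := (2 * 3 ^+ d : R).

(* The skew box with center [cb_c] and directions [cb_w] approximates the cap of
   the parallel body at [cb_x + e *: cb_u]; [cb_v] is the basis dual to [cb_w]. *)
Record cap_box := CapBox {
  cb_x : V; cb_u : V; cb_c : V; cb_v : 'I_d -> V; cb_w : 'I_d -> V }.

Record is_cap_box (K : set V) (e delta : R) (q : cap_box) : Prop := {
  cb_normal : normal_pair K (cb_x q) (cb_u q);
  cb_vdiag : forall k, 0 < cb_v q k 0 k;
  cb_vtri : triangular (fun j => d - j)%N (cb_v q);
  cb_wtri : triangular (fun j => j : nat) (cb_w q);
  cb_wdiag : forall k, cb_w q k 0 k = (cb_v q k 0 k)^-1;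
  cb_dual : forall x, x = \sum_k dot x (cb_w q k) *: cb_v q k;
  cb_inner : skew_box (cb_c q) (cb_w q) (2 * d%:R)^-1 `<=`
    cap K e delta (cb_x q) (cb_u q);
  cb_outer : forall x y k, cap K e delta (cb_x q) (cb_u q) x ->
    cap K e delta (cb_x q) (cb_u q) y -> `|dot (x - y) (cb_w q k)| <= kappa }.

Definition apex (e : R) (q : cap_box) := cb_x q + e *: cb_u q.
(** Half the radius of [cb_inner], leaving room to extrapolate beyond a point of the box. *)
Definition primal_box (q : cap_box) := skew_box (cb_c q) (cb_w q) (4 * d%:R)^-1.
(** The polar box: [cb_v] replaces [cb_w], so for fixed [t] its volume is inversely proportional to
    that of [primal_box]. *)
Definition dual_box (t : R) (q : cap_box) := skew_box (cb_u q) (cb_v q) t.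

Hypothesis d0 : (0 < d)%N.
Variables (K : set V) (e delta : R).
Hypotheses (Kcvx : Defs.convex_set K) (delta0 : 0 < delta) (delta_e : delta <= e).

Let e0 : 0 <= e. Proof. exact: le_trans (ltW delta0) delta_e. Qed.
Let dr : 0 < d%:R :> R. Proof. by rewrite ltr0n. Qed.
Let kappa0 : 0 < kappa. Proof. by rewrite mulr_gt0 ?exprn_gt0. Qed.

Lemma exists_cap_box B x u : (forall y, K y -> enorm y <= B) ->
  normal_pair K x u -> exists q, [/\ is_cap_box K e delta q, cb_x q = x & cb_u q = u].
Proof.
move=> KB xu.
have d2 : 0 < delta / 2 by rewrite divr_gt0.
have [||c [v [w [[v0 vt wt wk vw] box wid]]]] :=
  @convex_skew_box R d (cap K e delta x u) (B + e) (delta / 2)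
    (x + (e - delta / 2) *: u) d0 (@convex_cap R d K e delta x u Kcvx) _ d2.
- by move=> y [Ly _]; apply: parallel_body_bounded KB _ Ly.
- by move=> y yc; apply: ball_sub_cap => //; exact: ltW.
by exists (CapBox x u c v w); split => //; split.
Qed.

Lemma primal_box_sub_cap q : is_cap_box K e delta q ->
  primal_box q `<=` cap K e delta (cb_x q) (cb_u q).
Proof.
move=> gq y yq; apply: (cb_inner gq) => k; apply: le_trans (yq k) _.
by rewrite lef_pV2 ?posrE ?mulr_gt0// ler_pM2r// ler_nat.
Qed.

(** Going from the apex of [q] through the common point [y] and past it by the fraction [h] stays in
    the cap of [q], hence below the supporting hyperplane at the apex of [i]. As [y] is within
    [delta] of that hyperplane, the apex of [q] is within [(1 + h^-1) * delta]. *)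
Lemma primal_box_meet q i y : is_cap_box K e delta q -> is_cap_box K e delta i ->
  primal_box q y -> primal_box i y ->
  dot (apex e i - apex e q) (cb_u i) <= (1 + 4 * d%:R * kappa) * delta.
Proof.
move=> gq gi yq yi.
pose h := (4 * d%:R * kappa)^-1.
have h0 : 0 < h by rewrite invr_gt0 !mulr_gt0 ?exprn_gt0.
have zq : cap K e delta (cb_x q) (cb_u q) (apex e q).
  exact: (apex_cap e0 (ltW delta0) (cb_normal gq)).
have yq' : cap K e delta (cb_x q) (cb_u q) y by exact: primal_box_sub_cap.
have [_ yi'] : cap K e delta (cb_x i) (cb_u i) y by exact: primal_box_sub_cap.
pose y' := y - h *: (apex e q - y).
have [Ly' _] : cap K e delta (cb_x q) (cb_u q) y'.
  apply: (cb_inner gq) => k.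
  have -> : y' - cb_c q = (y - cb_c q) - h *: (apex e q - y).
    by apply/rowP => j; rewrite !mxE; ring.
  rewrite dotBl dotZl; apply: le_trans (ler_normB _ _) _.
  have := yq k; have := cb_outer gq k zq yq'.
  rewrite normrM (gtr0_norm h0) => b1 b2.
  have b3 : h * `|dot (apex e q - y) (cb_w q k)| <= h * kappa by rewrite ler_pM2l.
  have E1 : h * kappa = (4 * d%:R)^-1.
    by rewrite /h; field; rewrite !gt_eqF// exprn_gt0.
  have E2 : (2 * d%:R)^-1 = (4 * d%:R)^-1 + (4 * d%:R)^-1 :> R.
    by field; rewrite gt_eqF.
  by rewrite E2; rewrite E1 in b3; lra.
have /= := parallel_body_support e0 (cb_normal gi) Ly'.
rewrite -/(apex e i) in yi' *.
have -> : y' - apex e i =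
    - (apex e i - y) + h *: (apex e i - apex e q) - h *: (apex e i - y).
  by apply/rowP => j; rewrite !mxE; ring.
have key (A B u : V) :
    dot (- A + h *: B - h *: A) u = - dot A u + h * dot B u - h * dot A u.
  by rewrite !dot_lin; ring.
rewrite key.
move: yi'; move: (dot (apex e i - y) _) (dot (apex e i - apex e q) _) => a b ad hb.
have -> : (1 + 4 * d%:R * kappa) * delta = delta + h^-1 * delta.
  by rewrite /h invrK; ring.
rewrite -(ler_pM2l h0) mulrDr mulVKf ?gt_eqF//.
have := ler_wpM2l (ltW h0) ad; lra.
Qed.

Local Notation tau := (delta / (d%:R * kappa)).

(** Expanding [y - y'] in the basis [cb_v] leaves [d] terms, each at most [kappa * tau = delta / d];
    this fixes [tau]. *)
Lemma dual_box_pairing q u y y' : is_cap_box K e delta q -> dual_box tau q u ->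
  cap K e delta (cb_x q) (cb_u q) y -> cap K e delta (cb_x q) (cb_u q) y' ->
  dot (y - y') (u - cb_u q) <= delta.
Proof.
move=> gq uq yc yc'; rewrite (cb_dual gq (y - y')) dot_suml.
apply: le_trans (_ : \sum_(k < d) kappa * tau <= _).
  apply: ler_sum => k _; rewrite dotZl; apply: le_trans (ler_norm _) _.
  rewrite normrM ler_pM// ?normr_ge0//; first exact: (cb_outer gq).
  by rewrite dotC; exact: uq.
rewrite sumr_const card_ord -[_ *+ d]mulr_natl le_eqVlt; apply/orP; left; apply/eqP.
by field; rewrite !gt_eqF// exprn_gt0.
Qed.

(** Pairing [u - cb_u q] with a parallel diameter of the ball of [ball_sub_cap] gives
    [delta * enorm (u - cb_u q) <= delta]. *)
Lemma dual_box_enorm q u : is_cap_box K e delta q -> dual_box tau q u -> enorm u <= 2.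
Proof.
move=> gq uq; have [_ u1 _] := cb_normal gq.
suff : enorm (u - cb_u q) <= 1.
  by have := enormD (u - cb_u q) (cb_u q); rewrite subrK u1; lra.
have [->|un0] := eqVneq (u - cb_u q) 0; first by rewrite enorm0.
set b := (enorm (u - cb_u q))^-1 *: (u - cb_u q).
have b1 : enorm b = 1 by exact: enorm_unit.
pose c := cb_x q + (e - delta / 2) *: cb_u q.
have cb s : `|s| = 1 -> cap K e delta (cb_x q) (cb_u q) (c + (s * (delta / 2)) *: b).
  move=> s1; apply: (ball_sub_cap (ltW delta0) delta_e (cb_normal gq)).
  rewrite addrAC subrr add0r enormZ b1 mulr1 normrM s1 mul1r ger0_norm// divr_ge0//; exact: ltW.
have := dual_box_pairing gq uq (cb 1 (normr1 _)) (cb (-1) (normrN1 _)).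
have key (a s : V) : a + (1 * (delta / 2)) *: s - (a + (-1 * (delta / 2)) *: s) = delta *: s.
  by apply/rowP => j; rewrite !mxE; lra.
rewrite key.
rewrite dotZl ger_pMr// /b dotZl -sqr_enorm expr2 mulKf// gt_eqF// enorm_gt0//.
Qed.

(** Inside the cap [dual_box_pairing] applies directly. A deeper point [y] is moved along the
    segment to the apex up to depth [delta], and the bound there scales back to [y]. *)
Lemma dual_box_support q u y : is_cap_box K e delta q -> dual_box tau q u ->
  parallel_body K e y -> dot (y - apex e q) u <= delta.
Proof.
move=> gq uq Ly; set z := apex e q.
have zq : cap K e delta (cb_x q) (cb_u q) z.
  exact: (apex_cap e0 (ltW delta0) (cb_normal gq)).
have split_u x : dot x u = dot x (u - cb_u q) + dot x (cb_u q).
  by rewrite dotBr subrK.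
have nonpos := parallel_body_support e0 (cb_normal gq) Ly.
rewrite -/(apex e q) -/z in nonpos.
have [yd|yd] := lerP (dot (z - y) (cb_u q)) delta.
  have yq : cap K e delta (cb_x q) (cb_u q) y by split.
  by rewrite split_u; have := dual_box_pairing gq uq yq zq; lra.
set s := dot (z - y) _ in yd.
have s0 : 0 < s by apply: lt_trans yd.
pose t := delta / s.
have t0 : 0 < t by rewrite divr_gt0.
have t1 : t <= 1 by rewrite ler_pdivrMr// mul1r ltW.
pose y' := t *: y + (1 - t) *: z.
have yz : y' - z = t *: (y - z) by apply/rowP => j; rewrite !mxE; ring.
have yq : cap K e delta (cb_x q) (cb_u q) y'.
  split.
    by apply: convex_parallel_body => //; [case: zq|exact: ltW].
  rewrite -/(apex e q) -/z -opprB yz dotNl dotZl -mulrN -dotNl opprB -/s.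
  by rewrite divfK// gt_eqF.
have := dual_box_pairing gq uq yq zq; rewrite yz dotZl.
have sN : dot (y - z) (cb_u q) = - s by rewrite /s -dotNl opprB.
rewrite split_u sN => h.
have ts : t * s = delta by rewrite divfK// gt_eqF.
suff : dot (y - z) (u - cb_u q) <= s by have := delta0; lra.
by rewrite -(ler_pM2l t0) ts.
Qed.

(** Halving the radius puts the reflected direction [2 *: u - cb_u i] in the full box of [i]. It and
    [u] almost support the body at the two apexes; twice the inequality for [u] plus that for the
    reflection isolates [cb_u i]. *)
Lemma dual_box_meet q i u : is_cap_box K e delta q -> is_cap_box K e delta i ->
  dual_box (tau / 2) q u -> dual_box (tau / 2) i u ->
  dot (apex e i - apex e q) (cb_u i) <= 3 * delta.
Proof.
move=> gq gi uq ui.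
have tau0 : 0 < tau by rewrite divr_gt0 ?mulr_gt0 ?exprn_gt0.
have uq' : dual_box tau q u by move=> k; apply: le_trans (uq k) _; lra.
have ui' : dual_box tau i (2 *: u - cb_u i).
  move=> k; have -> : 2 *: u - cb_u i - cb_u i = 2 *: (u - cb_u i).
    by apply/rowP => j; rewrite !mxE; ring.
  by rewrite dotZl normrM normr_nat; have := ui k; lra.
have Lq : parallel_body K e (apex e q) by exact: (apex_parallel_body e0 (cb_normal gq)).
have Li : parallel_body K e (apex e i) by exact: (apex_parallel_body e0 (cb_normal gi)).
have := dual_box_support gq uq' Li; have := dual_box_support gi ui' Lq.
rewrite -(opprB (apex e i)) dotBr dotZr !dotNl; lra.
Qed.

End CapBoxes.

(** The bound [B] makes a disjoint family of largest size exist; an element whose set missed all its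
    members could be added. *)
Lemma maximal_disjoint_family (R : realType) (T U : Type) (Q : T -> Prop)
    (M : T -> set U) (B : R) :
  (forall n (f : 'I_n -> T), (forall i, Q (f i)) ->
     (forall i j x, M (f i) x -> M (f j) x -> i = j) -> n%:R <= B) ->
  exists n (f : 'I_n -> T), [/\ n%:R <= B, forall i, Q (f i) &
    forall q, Q q -> exists i x, M q x /\ M (f i) x].
Proof.
move=> QB.
pose P n := exists f : 'I_n -> T, (forall i, Q (f i)) /\
  (forall i j x, M (f i) x -> M (f j) x -> i = j).
have P0 : exists n, `[< P n >].
  exists 0%N; apply/asboolP.
  have f0 (i : 'I_0) : T by case: i.
  by exists f0; split => -[].
have PB n : `[< P n >] -> (n <= Num.truncn B)%N.
  move=> /asboolP [f [Qf disf]]; have nB := QB n f Qf disf.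
  have B0 : 0 <= B by apply: le_trans nB.
  by rewrite -ltnS -(ltr_nat R); apply: le_lt_trans nB _; case/andP: (truncn_itv B0).
case: (ex_maxnP P0 PB) => n /asboolP[f [Qf disf]] nmax.
exists n, f; split => //; first exact: QB.
move=> q Qq; apply: contrapT => no.
pose g (i : 'I_n.+1) := if unlift ord0 i is Some j then f j else q.
suff /asboolP/nmax : P n.+1 by rewrite ltnn.
exists g; split.
  by move=> i; rewrite /g; case: unliftP.
move=> i j x; rewrite /g; case: unliftP => [i' ->|->]; case: unliftP => [j' ->|->] //.
- by move=> /disf h /h ->.
- by move=> h1 h2; case: no; exists i', x.
- by move=> h1 h2; case: no; exists j', x.
Qed.

(** * Counting disjoint primal and dual boxes *)

Section PackingBounds.
Variables (R : realType) (m : nat).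
Local Notation d := m.+1.
Local Notation V := 'rV[R]_d.
Local Notation kappa := (2 * 3 ^+ d : R).
Variables (K : set V) (e delta : R).
Hypotheses (Kc : compact K) (Kcvx : Defs.convex_set K).
Hypotheses (delta0 : 0 < delta) (delta_e : delta < e).
Local Notation tau := (delta / (d%:R * kappa)).

Let e0 : 0 < e. Proof. exact: lt_trans delta_e. Qed.
Let kappa0 : 0 < kappa. Proof. by rewrite mulr_gt0 ?exprn_gt0. Qed.

(** All dual boxes lie in the ball of radius 2, a single covering set of coordinate spread 4; hence
    [(4 * 4) ^ d]. *)
Lemma dual_packing N (f : 'I_N -> cap_box R d) (t : R) : 0 < t ->
  (forall i, is_cap_box K e delta (f i)) -> (forall i, \prod_k cb_v (f i) k 0 k <= t) ->
  (forall i j x, dual_box (tau / 2) (f i) x -> dual_box (tau / 2) (f j) x -> i = j) ->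
  N%:R * ((tau / 2) ^+ d / t) <= 16 ^+ d.
Proof.
move=> t0 fg ft fdis.
have tau0 : 0 < tau by rewrite divr_gt0 ?mulr_gt0 ?exprn_gt0.
have tau20 : 0 < tau / 2 by rewrite divr_gt0.
have dle i x : dual_box (tau / 2) (f i) x -> enorm x <= 2.
  move=> xi; apply: (dual_box_enorm (ltn0Sn m) delta0 (ltW delta_e) (fg i)) => // k.
  by apply: le_trans (xi k) _; rewrite ler_pdivrMr// ler_peMr ?ler1n// ltW.
have := @skew_box_packing R d (fun j => d - j)%N N unit (fun i => cb_u (f i))
  (fun i => cb_v (f i)) (fun=> tau / 2) (fun=> [set x | enorm x <= 2]) (fun=> 4)
  ((tau / 2) ^+ d / t) 2.
rewrite big_const card_unit /= addr0 -natrM; apply => //.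
- by move=> i; exact: cb_vtri (fg i).
- by move=> i; exact: cb_vdiag (fg i).
- move=> i; rewrite big_split /= prodr_const card_ord prodfV ler_pM2l ?exprn_gt0//.
  by rewrite lef_pV2 ?posrE// prodr_gt0// => k _; exact: cb_vdiag (fg i) k.
- by move=> i x k /dle; apply: le_trans; exact: normr_coord_le.
- by move=> i x /dle; exists tt.
- move=> _ x y k /= x2 y2; apply: le_trans (ler_normB _ _) _.
  by have := normr_coord_le x k; have := normr_coord_le y k; lra.
Qed.

Lemma cap_outside q y : is_cap_box K e delta q ->
  cap K e delta (cb_x q) (cb_u q) y -> ~ K y.
Proof.
move=> gq [_ yd] Ky; have [_ u1 un] := cb_normal gq.
have := un y Ky; move: yd; rewrite dotBl dotDl dotZl (enorm1 u1) dotBl.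
have := delta_e; lra.
Qed.

Lemma nearest_normal_pair y : K !=set0 -> ~ K y ->
  exists k u t, [/\ normal_pair K k u, 0 < t, y = k + t *: u &
    forall x, K x -> t <= enorm (y - x)].
Proof.
move=> K0 Ky; have [k Kk kmin] := nearest_point y Kc K0.
have yk : y - k != 0 by apply/eqP => /eqP; rewrite subr_eq0 => /eqP yk; rewrite yk in Ky.
have t0 := enorm_gt0 yk.
exists k, ((enorm (y - k))^-1 *: (y - k)), (enorm (y - k)); split => //.
  split => //; first exact: enorm_unit.
  move=> x Kx; rewrite dotZr pmulr_rle0 ?invr_gt0//.
  exact: (nearest_point_normal Kcvx Kk kmin Kx).
by rewrite scalerA mulfV ?gt_eqF// scale1r addrC subrK.
Qed.

(** A shell point is followed along its normal ray to the boundary of the dilate of [K] by [l], and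
    classed by the piece [W i] met after rescaling and by its height in steps of [rho i]. Flowing
    back contracts, so each class has diameter at most [(l + 1) * rho i]. *)
Lemma primal_packing N (f : 'I_N -> cap_box R d) (t b : R) (p : V)
    n (W : 'I_n -> set V) (rho : 'I_n -> R) :
  0 < t -> 0 < b -> (forall y, enorm (y - p) <= b -> K y) ->
  (forall i, is_cap_box K e delta (f i)) -> (forall i, t <= \prod_k cb_v (f i) k 0 k) ->
  (forall i j x, primal_box (f i) x -> primal_box (f j) x -> i = j) ->
  (forall x, boundary K x -> exists i, W i x) ->
  (forall i x y, W i x -> W i y -> enorm (x - y) <= rho i) ->
  (forall i, 0 < rho i <= 2 * e) ->
  N%:R * ((4 * d%:R)^-1 ^+ d * t) <=
    3 * e * (4 * (2 + e / b)) ^+ d * \sum_i rho i ^+ m.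
Proof.
move=> t0 b0 ball fg ft fdis bW Wrho rho0.
have dr : 0 < d%:R :> R by rewrite ltr0n.
have rhop i : 0 < rho i by case/andP: (rho0 i).
pose l := 1 + e / b.
have l0 : 0 < l by rewrite ltr_pwDl// divr_ge0// ltW.
have [B KB] := compact_enorm_bounded Kc.
have Kne : K !=set0 by exists p; apply: ball; rewrite subrr enorm0 ltW.
pose S i := (Num.truncn (e / rho i)).+1.
pose J := {i : 'I_n & 'I_(S i)}.
pose Z (j : J) : set V := [set y | exists k u s s', [/\ normal_pair K k u,
  y = k + s *: u, 0 <= s <= s', (tagged j)%:R * rho (tag j) <= s <= (tagged j).+1%:R * rho (tag j)
  & W (tag j) (p + l^-1 *: (k + s' *: u - p))] ].
pose D (j : J) := (l + 1) * rho (tag j).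
have D0 j : 0 < D j by rewrite mulr_gt0// addr_gt0.
have capf i x : primal_box (f i) x -> cap K e delta (cb_x (f i)) (cb_u (f i)) x.
  by apply: (primal_box_sub_cap (ltn0Sn m)).
have := @skew_box_packing R d (fun j => j : nat) N J (fun i => cb_c (f i))
  (fun i => cb_w (f i)) (fun=> (4 * d%:R)^-1) Z D ((4 * d%:R)^-1 ^+ d * t) (B + e).
have -> : \sum_j (4 * D j) ^+ d =
    \sum_i \sum_(s < S i) (4 * (l + 1) * rho i) ^+ d.
  by rewrite sig_big_dep /=; apply: eq_bigr => j _; rewrite /D mulrA.
move=> H; apply: (le_trans (H _ _ _ _ _ _ _ _ _)) => {H} //.
- by move=> i; exact: cb_wtri (fg i).
- by move=> i k; rewrite (cb_wdiag (fg i)) invr_gt0; exact: cb_vdiag (fg i) k.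
- move=> i; rewrite big_split /= prodr_const card_ord ler_pM2l ?exprn_gt0 ?invr_gt0 ?mulr_gt0//.
  under eq_bigr do rewrite (cb_wdiag (fg i)) invrK.
  exact: ft.
- move=> i x k /capf [Lx _]; apply: le_trans (normr_coord_le x k) _.
  exact: parallel_body_bounded KB _ Lx.
- move=> i y /capf yc; have Ky := cap_outside (fg i) yc.
  have [k [u [s [ku s0 yE smin]]]] := nearest_normal_pair Kne Ky.
  have [Kk u1 _] := ku.
  have se : s <= e by case: yc => -[x Kx yx] _; apply: le_trans (smin x Kx) yx.
  have Ku : K (p + l^-1 *: (k + e *: u - p)).
    by apply: parallel_body_sub_dilate => //; [exact: ltW|exact: apex_parallel_body (ltW e0) ku].
  have [s' es' /bW[w Ww]] := boundary_ray l0 KB u1 Ku.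
  have sr : 0 <= s / rho w by rewrite divr_ge0// ltW.
  have /andP[t1 t2] := truncn_itv sr.
  have tS : (Num.truncn (s / rho w) < S w)%N.
    have er : 0 <= e / rho w by rewrite divr_ge0// ltW.
    have /andP[_ t3] := truncn_itv er.
    rewrite -(ltr_nat R); apply: le_lt_trans t1 (le_lt_trans _ t3).
    by rewrite ler_pM2r ?invr_gt0.
  exists (Tagged (fun i => 'I_(S i)) (Ordinal tS)); exists k, u, s, s'; split => //=.
    by rewrite (ltW s0) (le_trans se).
  by rewrite -ler_pdivlMr// t1 -ler_pdivrMr// ltW.
- move=> [w j] y y' k /= [k1 [u1 [s1 [s1' [n1 -> /andP[s10 s11] /andP[a1 b1] W1]]]]].
  move=> [k2 [u2 [s2 [s2' [n2 -> /andP[s20 s21] /andP[a2 b2] W2]]]]].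
  rewrite /D /=.
  have -> : forall x y : V, x 0 k - y 0 k = (x - y) 0 k by move=> x z; rewrite !mxE.
  apply: le_trans (normr_coord_le _ k) _.
  (* Both points are lowered to the common height [s], where the contraction applies; the heights
     given up total at most [rho w]. *)
  pose s := Num.min s1 s2.
  have sm1 : s <= s1 by rewrite ge_min lexx.
  have sm2 : s <= s2 by rewrite ge_min lexx orbT.
  have sm0 : 0 <= s by rewrite le_min s10.
  have sE : (s1 - s) + (s2 - s) <= rho w.
    rewrite -natr1 in b1 b2; rewrite /s; case: (lerP s1 s2) => _; lra.
  have -> : k1 + s1 *: u1 - (k2 + s2 *: u2) =
      (k1 + s *: u1 - (k2 + s *: u2)) + ((s1 - s) *: u1 - (s2 - s) *: u2).
    by apply/rowP => i; rewrite !mxE; ring.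
  apply: le_trans (enormD _ _) _; rewrite mulrDl mul1r; apply: lerD.
    apply: (le_trans (normal_ray_contraction n1 n2 sm0 (le_trans sm1 s11) (le_trans sm2 s21))).
    have := Wrho _ _ _ W1 W2.
    have -> : p + l^-1 *: (k1 + s1' *: u1 - p) - (p + l^-1 *: (k2 + s2' *: u2 - p)) =
        l^-1 *: (k1 + s1' *: u1 - (k2 + s2' *: u2)).
      by apply/rowP => i; rewrite !mxE; ring.
    by rewrite enormZ ger0_norm ?invr_ge0 ?(ltW l0)// ler_pdivrMl.
  apply: le_trans (enormD _ _) _; rewrite enormN !enormZ.
  have [_ -> _] := n1; have [_ -> _] := n2.
  by rewrite !mulr1 !ger0_norm ?subr_ge0.
rewrite mulr_sumr; apply: ler_sum => i _.
rewrite sumr_const card_ord -[_ *+ S i]mulr_natl exprMn.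
have l2 : l + 1 = 2 + e / b by rewrite /l; ring.
rewrite l2 [rho i ^+ d]exprS; set A := (4 * _) ^+ d.
have A0 : 0 <= A by rewrite exprn_ge0// mulr_ge0// addr_ge0// divr_ge0// ltW.
(* There are at most [e / rho i + 1] height steps, and [rho i <= 2 * e]. *)
have Si : (S i)%:R * rho i <= 3 * e.
  rewrite /S -natr1 mulrDl mul1r.
  have er : 0 <= e / rho i by rewrite divr_ge0// ltW.
  have /andP[t1 _] := truncn_itv er; rewrite ler_pdivlMr// in t1.
  by case/andP: (rho0 i) => _; lra.
have := ler_wpM2r (mulr_ge0 A0 (exprn_ge0 m (ltW (rhop i)))) Si.
by rewrite [leLHS](_ : _ = (S i)%:R * (A * (rho i * rho i ^+ m))) ?mulrA//; ring.
Qed.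

End PackingBounds.

(** A factor [A >= 1] moves inside the power as [A ^ 2], since [(A ^ 2) ^ (m / 2) = A ^ m >= A]. The
    2 turns a radius into a diameter. *)
Lemma powR_half_scale (R : realType) (m : nat) (A x : R) : (0 < m)%N -> 1 <= A -> 0 < x ->
  A * x `^ (m%:R / 2) <= (A ^+ 2 * (2 * x)) `^ (m%:R / 2).
Proof.
move=> m0 A1 x0; have Ap : 0 < A by lra.
apply: le_trans (_ : (A ^+ 2 * x) `^ (m%:R / 2) <= _); last first.
  have le2 : A ^+ 2 * x <= A ^+ 2 * (2 * x) by rewrite ler_pM2l ?exprn_gt0//; lra.
  have ge0 : 0 <= A ^+ 2 * x by rewrite mulr_ge0 ?exprn_ge0// ltW.
  by apply: ge0_ler_powR; rewrite // nnegrE ?(le_trans ge0).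
have A0 := ltW Ap; have x0' := ltW x0.
rewrite powRM ?exprn_ge0// ler_pM2r ?powR_gt0//.
rewrite -powR_mulrn// -powRrM mulrCA mulfV ?mulr1// powR_mulrn//.
by rewrite -(prednK m0) exprS ler_peMr ?exprn_ege1// ltW.
Qed.

Lemma sqr_powR_half (R : realType) (m : nat) (x : R) : 0 < x ->
  (x `^ (m%:R / 2)) ^+ 2 = x ^+ m.
Proof.
move=> x0; rewrite -powR_mulrn ?powR_ge0// -powRrM divfK// powR_mulrn//.
exact: ltW.
Qed.

Lemma hausdorff_dist_le (R : realType) (d : nat) (K P : set 'rV[R]_d) (e : R) :
  0 <= e -> K `<=` P ->
  (forall y, P y -> exists2 k, K k & enorm (y - k) <= e) ->
  (hausdorff_dist K P <= e%:E)%E.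
Proof.
move=> e0 KP PK; rewrite /hausdorff_dist ge_max; apply/andP; split.
  apply: ge_ereal_sup => _ [a Ka <-].
  apply: le_trans (_ : (enorm (a - a))%:E <= _)%E.
    by apply: ereal_inf_lbound; exists a => //; exact: KP.
  by rewrite subrr enorm0 lee_fin.
apply: ge_ereal_sup => _ [y /PK[k Kk yk] <-].
apply: le_trans (_ : (enorm (y - k))%:E <= _)%E; last by rewrite lee_fin.
by apply: ereal_inf_lbound; exists k.
Qed.

(** * Choice of constants and construction of the polytope *)

Section Approximation.
Variables (R : realType) (m : nat).
Local Notation d := m.+1.
Local Notation V := 'rV[R]_d.
Local Notation dr := (d%:R : R).
Local Notation kappa := (2 * 3 ^+ d : R).

(** The ratio [delta / e], small enough that the bounds of [primal_box_meet] and [dual_box_meet] are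
    at most [e / 2], as [halfspace_cut] requires. *)
Definition cap_ratio : R := (2 * (1 + 4 * dr * kappa))^-1.
Definition primal_const : R :=
  (4 * dr) ^+ d * (3 * (4 * (2 + 2 * dr * kappa)) ^+ d *
    (2 ^+ m * (3 * (2 * dr * (3 * dr ^+ 2) ^+ m)))).
Definition dual_const : R := 16 ^+ d * (2 * dr * kappa / cap_ratio) ^+ d.

Lemma cap_ratio_gt0 : 0 < cap_ratio.
Proof. by rewrite invr_gt0 mulr_gt0// addr_gt0// !mulr_gt0 ?exprn_gt0. Qed.

Lemma cap_ratioE : (1 + 4 * dr * kappa) * cap_ratio = 1 / 2.
Proof.
have : 0 < dr * kappa by rewrite !mulr_gt0 ?exprn_gt0.
rewrite /cap_ratio; set X := kappa; set Y := dr => X0.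
by field; nra.
Qed.

Lemma cap_ratio_le : 3 * cap_ratio <= 1 / 2.
Proof.
have := cap_ratio_gt0; have := cap_ratioE.
have h1 : 1 <= dr by rewrite ler1n.
have h2 : 1 <= 3 ^+ d :> R by rewrite exprn_ege1// ler1n.
have h3 : 1 <= dr * 3 ^+ d by nra.
move: cap_ratio => a E a0.
have -> : 3 * a = (1 + 2) * a by ring.
rewrite -E ler_pM2r//.
move: (dr * _) h3 => X; nra.
Qed.

Variables (K : set V) (e r : R) (x0 : V).
Hypotheses (m0 : (0 < m)%N) (Kbody : convex_body K) (e0 : 0 < e) (r0 : 0 < r).
Hypothesis widthK : forall u : V, enorm u = 1 -> e <= width K u.
Hypothesis areaK : hausdorff_measure m (boundary (cball x0 r)) =
  hausdorff_measure m (boundary K).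

Let delta := cap_ratio * e.
Let delta0 : 0 < delta. Proof. by rewrite mulr_gt0// cap_ratio_gt0. Qed.
Let delta_e : delta < e.
Proof.
by rewrite /delta gtr_pMl//; have := cap_ratio_le; have := cap_ratio_gt0; lra.
Qed.
Let rate := (r / e) `^ (m%:R / 2).
Let rate0 : 0 < rate. Proof. by rewrite powR_gt0// divr_gt0. Qed.
(** Threshold on the product of the [cb_v q k 0 k]. Up to constants there are at most
    [e * r ^ m / t] disjoint primal boxes above it and [t / e ^ d] disjoint dual boxes below it;
    this value makes both equal to [rate]. *)
Let t := e ^+ d * rate.
Let t0 : 0 < t. Proof. by rewrite mulr_gt0 ?exprn_gt0. Qed.
Let Kc : compact K. Proof. by case: Kbody. Qed.
Let Kcvx : Defs.convex_set K. Proof. by case: Kbody. Qed.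

Lemma primal_family_bound N (f : 'I_N -> cap_box R d) :
  (forall i, is_cap_box K e delta (f i) /\ t <= \prod_k cb_v (f i) k 0 k) ->
  (forall i j x, primal_box (f i) x -> primal_box (f j) x -> i = j) ->
  N%:R <= primal_const * rate.
Proof.
move=> fg fdis.
have dp : 0 < dr by rewrite ltr0n.
have [p ball] := inball_of_width (ltn0Sn m) Kbody e0 widthK.
have b0 : 0 < e / (2 * dr * kappa) by rewrite divr_gt0 ?mulr_gt0 ?exprn_gt0.
pose c := 2 * dr * (3 * dr ^+ 2 * r) ^+ m.
have c0 : 0 < c by rewrite !(mulr_gt0, exprn_gt0).
have HK : (hausdorff_measure m (boundary K) <= c%:E)%E.
  by rewrite -areaK; exact: hausdorff_sphere_le.
have [n [W [rho [WK Wrho rho0 rhosum]]]] :=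
  hausdorff_finite_cover m0 (compact_boundary Kc) c0 e0 HK.
have := primal_packing Kc Kcvx delta0 delta_e t0 b0 ball (fun i => (fg i).1)
  (fun i => (fg i).2) fdis WK Wrho rho0.
have -> : e / (e / (2 * dr * kappa)) = 2 * dr * kappa.
  by field; rewrite !gt_eqF// exprn_gt0.
set A := (4 * (2 + _)) ^+ d => H.
have A0 : 0 <= A by rewrite exprn_ge0// mulr_ge0// addr_ge0// !mulr_ge0// exprn_ge0.
have {}H : N%:R * ((4 * dr)^-1 ^+ d * t) <= 3 * e * A * (2 ^+ m * (3 * c)).
  apply: le_trans H _; apply: ler_wpM2l => //.
  by rewrite !mulr_ge0// ltW.
have q0 : 0 < (4 * dr)^-1 ^+ d * t by rewrite mulr_gt0// exprn_gt0// invr_gt0 mulr_gt0.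
rewrite -(ler_pM2r q0); apply: le_trans H _.
have rE : r ^+ m = e ^+ m * rate ^+ 2.
  rewrite sqr_powR_half ?divr_gt0// expr_div_n mulrC divfK// gt_eqF// exprn_gt0//.
rewrite le_eqVlt; apply/orP; left; apply/eqP.
rewrite /primal_const -/A /c exprMn rE /t exprS [e ^+ d]exprS [(4 * dr)^-1 ^+ d]exprVn.
set Q := (4 * dr) ^+ d.
have Q0 : Q != 0 by rewrite gt_eqF// exprn_gt0// mulr_gt0.
by field.
Qed.

Lemma dual_family_bound N (f : 'I_N -> cap_box R d) :
  (forall i, is_cap_box K e delta (f i) /\ \prod_k cb_v (f i) k 0 k <= t) ->
  (forall i j x, dual_box (delta / (dr * kappa) / 2) (f i) x ->
     dual_box (delta / (dr * kappa) / 2) (f j) x -> i = j) ->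
  N%:R <= dual_const * rate.
Proof.
move=> fg fdis.
have := dual_packing delta0 delta_e t0 (fun i => (fg i).1) (fun i => (fg i).2) fdis.
have dp : 0 < dr by rewrite ltr0n.
have a0 := cap_ratio_gt0.
pose s := 2 * dr * kappa / cap_ratio.
have s0 : 0 < s by rewrite divr_gt0// !mulr_gt0 ?exprn_gt0.
have -> : delta / (dr * kappa) / 2 = s^-1 * e.
  rewrite /s /delta; field.
  by rewrite !gt_eqF// exprn_gt0.
rewrite exprMn exprVn /t -ler_pdivlMr; last first.
  by rewrite divr_gt0 ?mulr_gt0 ?invr_gt0 ?exprn_gt0.
move=> H; apply: le_trans H _; rewrite /dual_const -/s le_eqVlt; apply/orP; left; apply/eqP.
set S := s ^+ d; set E := e ^+ d.
have S0 : S != 0 by rewrite gt_eqF// exprn_gt0.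
have E0 : E != 0 by rewrite gt_eqF// exprn_gt0.
by field; rewrite S0 E0 gt_eqF.
Qed.

(** Every normal pair has a cap box, and on its side of the threshold [t] its primal or dual box
    meets that of a member of the maximal family. *)
Lemma covering_family : exists n (f : 'I_n -> cap_box R d),
  [/\ n%:R <= (primal_const + dual_const) * rate,
      forall i, normal_pair K (cb_x (f i)) (cb_u (f i)) &
      forall x u, normal_pair K x u -> exists i,
        dot (apex e (f i) - (x + e *: u)) (cb_u (f i)) <= e / 2].
Proof.
have [B KB] := compact_enorm_bounded Kc.
have [n1 [f1 [n1B f1g f1c]]] := maximal_disjoint_family
  (Q := fun q => is_cap_box K e delta q /\ t <= \prod_k cb_v q k 0 k) primal_family_bound.
have [n2 [f2 [n2B f2g f2c]]] := maximal_disjoint_family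
  (Q := fun q => is_cap_box K e delta q /\ \prod_k cb_v q k 0 k <= t) dual_family_bound.
pose f (i : 'I_(n1 + n2)) := match fintype.split i with inl i => f1 i | inr i => f2 i end.
exists (n1 + n2)%N, f; split.
- by rewrite natrD mulrDl lerD.
- by move=> i; rewrite /f; case: fintype.split => j; [case: (f1g j)|case: (f2g j)] => /cb_normal.
move=> x u xu.
have [q [gq qx qu]] := exists_cap_box (ltn0Sn m) Kcvx delta0 (ltW delta_e) KB xu.
have qE : x + e *: u = apex e q by rewrite /apex qx qu.
have [tq|/ltW qt] := leP t (\prod_k cb_v q k 0 k).
  have [i [y [yq yi]]] := f1c q (conj gq tq); exists (lshift n2 i).
  rewrite /f -[lshift _ _]/(unsplit (inl i)) unsplitK qE.
  apply: le_trans (primal_box_meet (ltn0Sn m) delta0 (ltW delta_e) gq (f1g i).1 yq yi) _.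
  by rewrite /delta mulrA cap_ratioE; lra.
have [i [y [yq yi]]] := f2c q (conj gq qt); exists (rshift n1 i).
rewrite /f -[rshift _ _]/(unsplit (inr i)) unsplitK qE.
apply: le_trans (dual_box_meet (ltn0Sn m) Kcvx delta0 (ltW delta_e) gq (f2g i).1 yq yi) _.
rewrite /delta mulrA.
have := cap_ratio_le; rewrite -(ler_pM2r e0); lra.
Qed.

(** The halfspaces support [K] at the chosen normal pairs. A point farther than [e] from [K] lies
    beyond height [e] on a normal ray, where [halfspace_cut] puts it outside one of them;
    [facet_tight_halfspace] counts the facets. *)
Lemma approximating_polytope : exists P : set V,
  [/\ polytope P, K `<=` P, (hausdorff_dist K P <= e%:E)%E &
      num_facets_le P ((primal_const + dual_const) * rate)].
Proof.
have [n [f [nB fn fc]]] := covering_family.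
pose P : set V := [set x | forall i, dot (cb_u (f i)) x <= dot (cb_x (f i)) (cb_u (f i))].
have [B KB] := compact_enorm_bounded Kc.
have K0 : K !=set0.
  case: Kbody => _ _ [x [s [s0 xs]]]; exists x; apply: xs.
  by rewrite /= subrr enorm0.
have KP : K `<=` P.
  move=> x Kx i; have [_ _ /(_ x Kx)] := fn i.
  by rewrite dotBl (dotC _ x); lra.
have PK y : P y -> exists2 k, K k & enorm (y - k) <= e.
  move=> Py; have [Ky|nKy] := pselect (K y).
    by exists y; rewrite // subrr enorm0 ltW.
  have [k [u [s [ku s0 yE _]]]] := nearest_normal_pair Kc Kcvx K0 nKy.
  have [Kk u1 _] := ku; exists k => //.
  rewrite yE addrAC subrr add0r enormZ u1 mulr1 gtr0_norm// leNgt; apply/negP => es.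
  have [i ic] := fc k u ku.
  have := halfspace_cut e0 ku (fn i) ic es; rewrite -yE.
  by have := Py i; rewrite (dotC _ y); lra.
exists P; split => //.
- exists n, (fun i => cb_u (f i)), (fun i => dot (cb_x (f i)) (cb_u (f i))); split => //.
  by exists (B + e) => y /PK yK; exact: parallel_body_bounded KB y yK.
- by apply: hausdorff_dist_le => //; exact: ltW.
exists n, (fun i => [set x | P x /\ dot (cb_u (f i)) x = dot (cb_x (f i)) (cb_u (f i))]).
split => // F /facet_tight_halfspace; apply => // i.
have [_ u1 _] := fn i; apply/eqP => u0; move: u1; rewrite u0 enorm0 => /eqP.
by rewrite eq_sym oner_eq0.
Qed.

End Approximation.

Theorem theorem1 (R : realType) (d : nat) : (2 <= d)%N ->
  exists c : R, 0 < c /\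
  forall (K : set 'rV[R]_d) (eps : R),
    convex_body K -> 0 < eps ->
    (forall u : 'rV[R]_d, enorm u = 1 -> eps <= width K u) ->
    forall (x0 : 'rV[R]_d) (r : R), 0 < r ->
      hausdorff_measure d.-1 (boundary (cball x0 r)) =
        hausdorff_measure d.-1 (boundary K) ->
      exists P : set 'rV[R]_d,
        [/\ polytope P, K `<=` P, (hausdorff_dist K P <= eps%:E)%E &
            num_facets_le P ((c * (2 * r) / eps) `^ (d.-1%:R / 2))].
Proof.
case: d => [//|m]; rewrite ltnS => m0.
pose A := 1 + `|primal_const R m + dual_const R m|.
have A1 : 1 <= A by rewrite lerDl.
(* The square lets [powR_half_scale] absorb the factor [A]; the leading 1 in [A] ensures
   [1 <= A]. *)
exists (A ^+ 2); split; first by rewrite exprn_gt0//; lra.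
move=> K e Kb e0 wK x0 r r0 aK.
have [P [Pp KP hP [n [f [nB fP]]]]] := approximating_polytope m0 Kb e0 r0 wK aK.
exists P; split => //; exists n, f; split => //.
have -> : A ^+ 2 * (2 * r) / e = A ^+ 2 * (2 * (r / e)) by rewrite !mulrA.
apply: le_trans (powR_half_scale m0 A1 (divr_gt0 r0 e0)); apply: le_trans nB _.
rewrite ler_pM2r ?powR_gt0 ?divr_gt0//.
by apply: le_trans (ler_norm _) _; rewrite lerDr.
Qed.
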